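(* Let $g$ be a $C^1$ function near $0\in\mathbb{C}$ with $g(0)=0$, $g_z(0)=0$, $g_{\bar z}(0)=1$, such that $z^2$ and $g^2$ separate points near $0$. Let $F(w_1,w_2)$ be an odd holomorphic function near the origin of $\mathbb{C}^2$ with $F(w_1,w_2)=O(\|(w_1,w_2)\|^3)$, and write $(g+F(z,g))(z)=g(z)+F(z,g(z))$. Then for every closed disk $D$ centered at $0$ with sufficiently small radius, $$[\,z^2,\ g^2\,;\,D\,]=C(D)\iff[\,z^2,\ (g+F(z,g))^2\,;\,D\,]=C(D).$$
   Context: For continuous functions $f_1,f_2$ on a compact set $D\subset\mathbb{C}$, $[f_1,f_2;D]$ denotes the uniform closure in $C(D)$ of the set of polynomials (with complex coefficients) in $f_1$ and $f_2$. *)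

(* Defs.v *)
From HB Require Import structures.
From mathcomp Require Import all_boot all_order all_algebra.
From mathcomp Require Import reals.
From mathcomp Require Import complex.
Set Implicit Arguments.
Unset Strict Implicit.
Unset Printing Implicit Defensive.
Import Order.TTheory GRing.Theory Num.Theory.
Local Open Scope ring_scope.
Local Open Scope complex_scope.

Section Defs.
Variable R : realType.
Local Notation C := R[i].
Local Notation cabs := (@ComplexField.Normc.normc R).

Definition cdisk (r : R) : C -> Prop := fun z => cabs z <= r.
Definition odisk (r : R) : C -> Prop := fun z => cabs z < r.

Definition cont_on (D : C -> Prop) (h : C -> C) : Prop :=
  forall z, D z -> forall e : R, 0 < e -> exists2 d : R, 0 < d &
    forall w, D w -> cabs (w - z) < d -> cabs (h w - h z) < e.

Definition poly2_eval (n : nat) (c : nat -> nat -> C) (a b : C) : C :=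
  \sum_(i < n) \sum_(j < n) c i j * a ^+ i * b ^+ j.

Definition in_poly_closure (f1 f2 : C -> C) (D : C -> Prop) (h : C -> C) :
  Prop :=
  forall e : R, 0 < e -> exists n c,
    forall z, D z -> cabs (h z - poly2_eval n c (f1 z) (f2 z)) <= e.

Definition poly_closure_is_CD (f1 f2 : C -> C) (D : C -> Prop) : Prop :=
  forall h : C -> C, cont_on D h -> in_poly_closure f1 f2 D h.

Definition has_dx (g : C -> C) (p a : C) : Prop :=
  forall e : R, 0 < e -> exists2 d : R, 0 < d & forall t : R, t != 0 ->
    `|t| < d -> cabs ((g (p + t%:C) - g p) / t%:C - a) < e.
Definition has_dy (g : C -> C) (p a : C) : Prop :=
  forall e : R, 0 < e -> exists2 d : R, 0 < d & forall t : R, t != 0 ->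
    `|t| < d -> cabs ((g (p + t%:C * 'i) - g p) / t%:C - a) < e.

Definition has_dz (g : C -> C) (p w : C) : Prop :=
  exists ax ay, [/\ has_dx g p ax, has_dy g p ay & w = (ax - 'i * ay) / 2%:R].
Definition has_dzbar (g : C -> C) (p w : C) : Prop :=
  exists ax ay, [/\ has_dx g p ax, has_dy g p ay & w = (ax + 'i * ay) / 2%:R].

Definition C1_near0 (g : C -> C) : Prop :=
  exists2 r : R, 0 < r & exists gx gy : C -> C,
    [/\ forall p, odisk r p -> has_dx g p (gx p) /\ has_dy g p (gy p),
        cont_on (odisk r) gx & cont_on (odisk r) gy].

Definition separate_near0 (f1 f2 : C -> C) : Prop :=
  exists2 r : R, 0 < r & forall z1 z2, odisk r z1 -> odisk r z2 ->
    f1 z1 = f1 z2 -> f2 z1 = f2 z2 -> z1 = z2.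

Definition cnorm2 (w1 w2 : C) : R := Num.max (cabs w1) (cabs w2).

Definition holomorphic2_near0 (F : C -> C -> C) : Prop :=
  exists2 r : R, 0 < r & forall p1 p2, cnorm2 p1 p2 < r ->
    exists a b : C, forall e : R, 0 < e -> exists2 d : R, 0 < d &
      forall h1 h2, cnorm2 h1 h2 < d ->
        cabs (F (p1 + h1) (p2 + h2) - F p1 p2 - a * h1 - b * h2)
          <= e * cnorm2 h1 h2.

Definition odd2_near0 (F : C -> C -> C) : Prop :=
  exists2 r : R, 0 < r & forall w1 w2, cnorm2 w1 w2 < r ->
    F (- w1) (- w2) = - F w1 w2.

Definition bigO3_near0 (F : C -> C -> C) : Prop :=
  exists M r : R, 0 < r /\ forall w1 w2, cnorm2 w1 w2 < r ->
    cabs (F w1 w2) <= M * cnorm2 w1 w2 ^+ 3.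

End Defs.

(* Main.v *)
Require Import Defs.
From HB Require Import structures.
From mathcomp Require Import all_boot all_order all_algebra.
From mathcomp Require Import reals.
From mathcomp Require Import complex.
From mathcomp Require Import boolp classical_sets.
From mathcomp Require Import ring lra.
Import Order.TTheory GRing.Theory Num.Theory.
Local Open Scope ring_scope.
Local Open Scope complex_scope.

(* Put X = {(z, f(z))} and X' = X \cup -X, with f = g or f = g + F(z,g), over a small
   disk D. Since f is close to conj z, the function u = z f satisfies |1 - u| <= 1
   and |1 - u^2| <= 1, a region on which the square root is a uniform limit of
   polynomials; hence z f, a square root of z^2 f^2, lies in [z^2, f^2; D], and
   [z^2, f^2; D] is the even part of the closed algebra P(X') generated by the
   coordinates. Because F is odd, (z, w) |-> (z, w + F(z, w)) carries the set X' of g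
   onto that of G = g + F(z,g). It relates their algebras because F is locally a
   uniform limit of polynomials, and it is inverted by iterating the contraction
   w |-> G - F(z, w). So the closures for g and for G coincide.

   The analytic input on F (Goursat, Cauchy's formula, Lipschitz estimate) needs no
   integral: the boundary sums of a square over dyadic points are exactly additive
   under quartering and vanish on affine functions, so Goursat's bisection applies to
   the sums themselves, and Cauchy's formula becomes a statement on their size. *)

(** * Modulus of complex numbers *)

(** Substituting an odd [F] directly into the algebra of [z^2] and [g^2] would mean sorting an
    expansion of [F] by the parity of its monomials. On the doubled set both coordinates are
    generators, so [F] is substituted as a whole, and parity enters only once, when a polynomial is
    averaged over the two sheets. The polynomial approximation of [F] needs no power series: a
    Cauchy sum writes [F(Z, W)] through the functions [1/(x - Z)], which a closed algebra containing
    a small [Z] contains by the geometric series. The discrete winding sum that normalizes Cauchy's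
    formula is never shown to tend to 2 pi i. It is enough that it is bounded with imaginary part at
    least 1/3, because the algebra then contains its inverse. This is why the constants 16, 48 and
    192 are crude. *)

Section Modulus.
Context {R : realType}.
Local Notation C := R[i].
Local Notation cabs := (@ComplexField.Normc.normc R).
Implicit Types x y z : C.

Lemma cabs_ge0 z : 0 <= cabs z.
Proof. by case: z => a b; rewrite sqrtr_ge0. Qed.

Lemma cabs0 : cabs 0 = 0.
Proof. exact: ComplexField.Normc.normc0. Qed.

Lemma cabs1 : cabs 1 = 1.
Proof. exact: ComplexField.Normc.normc1. Qed.

Lemma cabsM x y : cabs (x * y) = cabs x * cabs y.
Proof. exact: ComplexField.Normc.normcM. Qed.

Lemma cabsV x : cabs x^-1 = (cabs x)^-1.
Proof. exact: ComplexField.Normc.normcV. Qed.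

Lemma cabsN x : cabs (- x) = cabs x.
Proof. exact: normcN. Qed.

Lemma cabsD x y : cabs (x + y) <= cabs x + cabs y.
Proof. exact: le_normcD. Qed.

Lemma cabsB x y : cabs (x - y) <= cabs x + cabs y.
Proof. by rewrite -(cabsN y) cabsD. Qed.

Lemma cabs_sub x y : cabs (x - y) = cabs (y - x).
Proof. by rewrite -cabsN opprB. Qed.

Lemma cabs_tri y x z : cabs (x - z) <= cabs (x - y) + cabs (y - z).
Proof. by rewrite -{1}[x](subrK y) -addrA cabsD. Qed.

Lemma cabs_eq0 x : (cabs x == 0) = (x == 0).
Proof.
apply/eqP/eqP => [|->]; last exact: cabs0.
exact: ComplexField.Normc.eq0_normc.
Qed.

Lemma cabs_gt0 x : (0 < cabs x) = (x != 0).
Proof. by rewrite lt_def cabs_ge0 andbT cabs_eq0. Qed.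

Lemma cabsX x n : cabs (x ^+ n) = cabs x ^+ n.
Proof. by elim: n => [|n IH]; rewrite ?cabs1 // !exprS cabsM IH. Qed.

Lemma cabs_sqr z : cabs z ^+ 2 = complex.Re z ^+ 2 + complex.Im z ^+ 2.
Proof. by case: z => a b /=; rewrite sqr_sqrtr // addr_ge0 ?sqr_ge0. Qed.

Lemma cabs_real (a : R) : cabs a%:C = `|a|.
Proof. by rewrite /= expr0n /= addr0 sqrtr_sqr. Qed.

Lemma cabs_i : cabs 'i = 1.
Proof. by rewrite /= expr0n /= add0r expr1n sqrtr1. Qed.

Lemma cabs_le_sqr z (a : R) : 0 <= a ->
  complex.Re z ^+ 2 + complex.Im z ^+ 2 <= a ^+ 2 -> cabs z <= a.
Proof.
by move=> a0; rewrite -cabs_sqr => h; rewrite -(@ler_pXn2r _ 2) ?nnegrE ?cabs_ge0.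
Qed.

Lemma Re_le_cabs z : `|complex.Re z| <= cabs z.
Proof.
rewrite -(@ler_pXn2r _ 2) ?nnegrE ?cabs_ge0 // real_normK ?num_real // cabs_sqr.
by rewrite lerDl sqr_ge0.
Qed.

Lemma Im_le_cabs z : `|complex.Im z| <= cabs z.
Proof.
rewrite -(@ler_pXn2r _ 2) ?nnegrE ?cabs_ge0 // real_normK ?num_real // cabs_sqr.
by rewrite lerDr sqr_ge0.
Qed.

Lemma cabs_le_ReIm z : cabs z <= `|complex.Re z| + `|complex.Im z|.
Proof.
apply: cabs_le_sqr; first by rewrite addr_ge0.
rewrite sqrrD !real_normK ?num_real //.
have : 0 <= `|complex.Re z| * `|complex.Im z| by rewrite mulr_ge0.
lra.
Qed.

Lemma cabs_sum (I : Type) (s : seq I) (f : I -> C) :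
  cabs (\sum_(i <- s) f i) <= \sum_(i <- s) cabs (f i).
Proof.
elim: s => [|i s IH]; first by rewrite !big_nil cabs0.
by rewrite !big_cons; apply: le_trans (cabsD _ _) _; rewrite lerD2l.
Qed.

Lemma cabs_nat n : cabs n%:R = n%:R.
Proof.
have -> : (n%:R : C) = (n%:R : R)%:C by rewrite rmorph_nat.
by rewrite cabs_real normr_nat.
Qed.

Lemma complex_eta z : z = (complex.Re z)%:C + (complex.Im z)%:C * 'i.
Proof. by rewrite {1}(complexE z) [_ * 'i]mulrC. Qed.

Lemma conjc_eta z : conjc z = (complex.Re z)%:C - (complex.Im z)%:C * 'i.
Proof.
case: z => a b; apply/eqP; rewrite eq_complex /=.
by apply/andP; split; apply/eqP; ring.
Qed.

Lemma ReD x y : complex.Re (x + y) = complex.Re x + complex.Re y.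
Proof. by case: x => a b; case: y. Qed.
Lemma ImD x y : complex.Im (x + y) = complex.Im x + complex.Im y.
Proof. by case: x => a b; case: y. Qed.
Lemma ReN x : complex.Re (- x) = - complex.Re x.
Proof. by case: x. Qed.
Lemma ImN x : complex.Im (- x) = - complex.Im x.
Proof. by case: x. Qed.
Lemma ReM x y : complex.Re (x * y) =
  complex.Re x * complex.Re y - complex.Im x * complex.Im y.
Proof. by case: x => a b; case: y. Qed.
Lemma ImM x y : complex.Im (x * y) =
  complex.Re x * complex.Im y + complex.Im x * complex.Re y.
Proof. by case: x => a b; case: y. Qed.
Lemma Re_real (a : R) : complex.Re a%:C = a. Proof. by []. Qed.
Lemma Im_real (a : R) : complex.Im a%:C = 0. Proof. by []. Qed.

Lemma Re_i : complex.Re ('i : C) = 0. Proof. by []. Qed.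
Lemma Im_i : complex.Im ('i : C) = 1. Proof. by []. Qed.
Lemma Re_1 : complex.Re (1 : C) = 1. Proof. by []. Qed.
Lemma Im_1 : complex.Im (1 : C) = 0. Proof. by []. Qed.
Lemma Re_0 : complex.Re (0 : C) = 0. Proof. by []. Qed.
Lemma Im_0 : complex.Im (0 : C) = 0. Proof. by []. Qed.

Definition ReImE := (ReD, ImD, ReN, ImN, ReM, ImM,
  Re_i, Im_i, Re_1, Im_1, Re_0, Im_0, Re_real, Im_real).

End Modulus.

(** Bernoulli's inequality for [1/q = 1 + b] makes the powers of [1/q] exceed any bound. *)
Lemma expr_small (R : realType) (q e : R) : 0 <= q -> q < 1 -> 0 < e ->
  exists n, q ^+ n <= e.
Proof.
move=> q0 q1 e0.
have [->|qn0] := eqVneq q 0; first by exists 1%N; rewrite expr1 ltW.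
have qp : 0 < q by rewrite lt_def qn0.
pose b := q^-1 - 1.
have b0 : 0 < b by rewrite subr_gt0 invf_gt1.
have bern n : 1 + n%:R * b <= (1 + b) ^+ n.
  elim: n => [|n IH]; first by rewrite mul0r addr0 expr0.
  rewrite exprS -natr1.
  have h : (1 + b) * (1 + n%:R * b) <= (1 + b) * (1 + b) ^+ n.
    by rewrite ler_pM2l //; lra.
  have : 0 <= n%:R * b ^+ 2 by rewrite mulr_ge0 // sqr_ge0.
  by move=> h2; apply: le_trans h; lra.
have [n hn] : exists n : nat, e^-1 / b < n%:R.
  exists (Num.truncn (e^-1 / b)).+1; exact: truncnS_gt.
exists n.
have qb : q = (1 + b)^-1 by rewrite /b addrC subrK invrK.
rewrite qb exprVn invf_ple ?posrE ?exprn_gt0 //; last by lra.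
apply: le_trans (bern n); move: hn; rewrite ltr_pdivrMr // => hn.
lra.
Qed.

(** * Uniformly closed algebras *)

Section ClosedAlgebra.
Context {R : realType} {T : Type} (D : T -> Prop).
Local Notation C := R[i].
Local Notation cabs := (@ComplexField.Normc.normc R).

(** Functions are total on [T], but limits are tested on [D] only; closure under limits therefore
    also makes membership depend on the values on [D] alone, which is [ca_ext]. *)
Record closed_algebra (A : (T -> C) -> Prop) : Prop := ClosedAlgebra {
  ca_const : forall c : C, A (fun _ => c);
  ca_add : forall f g, A f -> A g -> A (fun t => f t + g t);
  ca_mul : forall f g, A f -> A g -> A (fun t => f t * g t);
  ca_lim : forall f, (forall e : R, 0 < e ->
    exists2 g, A g & forall t, D t -> cabs (f t - g t) <= e) -> A f }.

Variable A : (T -> C) -> Prop.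
Hypothesis hA : closed_algebra A.

Lemma ca_ext f g : A g -> (forall t, D t -> f t = g t) -> A f.
Proof.
move=> Ag fg; apply: (ca_lim _ hA) => e e0; exists g => // t /fg ->.
by rewrite subrr cabs0 ltW.
Qed.

Lemma ca_scale c f : A f -> A (fun t => c * f t).
Proof. by move=> Af; apply: (ca_mul _ hA) => //; apply: (ca_const _ hA). Qed.

Lemma ca_opp f : A f -> A (fun t => - f t).
Proof. by move=> /(ca_scale (-1)) /ca_ext; apply=> t _; rewrite mulN1r. Qed.

Lemma ca_sub f g : A f -> A g -> A (fun t => f t - g t).
Proof. by move=> Af /ca_opp; apply: (ca_add _ hA). Qed.

Lemma ca_exp f n : A f -> A (fun t => f t ^+ n).
Proof.
move=> Af; elim: n => [|n IH]; first exact: (ca_const _ hA).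
by have /ca_ext := ca_mul _ hA _ _ Af IH; apply=> t _; rewrite exprS.
Qed.

Lemma ca_sum (I : Type) (s : seq I) (f : I -> T -> C) :
  (forall i, A (f i)) -> A (fun t => \sum_(i <- s) f i t).
Proof.
move=> Af; elim: s => [|i s IH].
  by have /ca_ext := ca_const _ hA 0; apply=> t _; rewrite big_nil.
by have /ca_ext := ca_add _ hA _ _ (Af i) IH; apply=> t _; rewrite big_cons.
Qed.

(* With [y = 1 - u^2], the iteration [q <- (y + q^2) / 2] started at [0] stays
   polynomial in [u^2] and converges to its fixed point [1 - u]; the real
   recursion for [d] (the case [y = 1]) majorizes the error. *)
Lemma ca_sqrt u : A (fun t => u t ^+ 2) ->
  (forall t, D t -> cabs (1 - u t) <= 1 /\ cabs (1 - u t ^+ 2) <= 1) -> A u.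
Proof.
move=> Au hu.
pose q := fix q n (t : T) : C :=
  if n is n'.+1 then ((1 - u t ^+ 2) + q n' t ^+ 2) / 2%:R else 0.
pose d := fix d n : R := if n is n'.+1 then d n' * (1 - d n' / 2) else 1.
have two0 : (2 : R) != 0 by rewrite pnatr_eq0.
have qA n : A (q n).
  elim: n => [|n IH]; first exact: (ca_const _ hA).
  apply: (ca_mul _ hA); last exact: (ca_const _ hA).
  apply: (ca_add _ hA); last exact: ca_exp.
  by apply: ca_sub => //; apply: (ca_const _ hA).
have d01 n : 0 <= d n <= 1.
  elim: n => [|n /andP[d0 d1]] /=; first by lra.
  by apply/andP; split; nra.
have half_le (x : C) (b : R) : cabs x <= 2 * b -> cabs (x / 2%:R) <= b.
  rewrite cabsM cabsV cabs_nat => h.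
  by rewrite ler_pdivrMr ?ltr0n // mulrC.
have q1 n t : D t -> cabs (q n t) <= 1 - d n.
  move=> Dt; elim: n => [|n IH]; first by rewrite cabs0 subrr.
  apply: half_le; apply: le_trans (cabsD _ _) _; rewrite cabsX.
  have h : cabs (q n t) ^+ 2 <= (1 - d n) ^+ 2.
    by apply: lerXn2r IH; rewrite ?nnegrE ?cabs_ge0 ?subr_ge0; case/andP: (d01 n).
  have [_ h2] := hu t Dt.
  move: h h2 => /=; nra.
have qd n t : D t -> cabs (q n t - (1 - u t)) <= d n.
  move=> Dt; have [h1 h2] := hu t Dt.
  elim: n => [|n IH]; first by rewrite /= sub0r cabsN.
  have -> : q n.+1 t - (1 - u t) =
      (q n t - (1 - u t)) * (q n t + (1 - u t)) / 2%:R.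
    by rewrite /=; field.
  apply: half_le; rewrite cabsM.
  have h3 : cabs (q n t + (1 - u t)) <= 2 - d n.
    by apply: le_trans (cabsD _ _) _; have := q1 n t Dt; lra.
  apply: le_trans (ler_pM (cabs_ge0 _) (cabs_ge0 _) IH h3) _.
  by rewrite /=; lra.
(* Each step raises [1/d] by at least 1/2, since [1/(1 - x/2) >= 1 + x/2]. No geometric rate is
   available, because [u] may vanish. *)
have dn n : d n * (n%:R + 2) <= 2.
  elim: n => [|n IH]; first by rewrite /=; lra.
  rewrite -natr1; have /andP[d0 d1] := d01 n.
  have n0 : (0 : R) <= n%:R by [].
  rewrite -[d n.+1]/(d n * (1 - d n / 2)).
  move: (d n) (n%:R : R) IH d0 d1 n0 => x m IH d0 d1 n0.
  have [h|h] := lerP 1 (x * (m + 1)); nra.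
apply: (ca_lim _ hA) => e e0.
pose n := (Num.truncn (2 / e)).+1.
have hn : 2 / e < n%:R by exact: truncnS_gt.
exists (fun t => 1 - q n t).
  by apply: ca_sub => //; apply: (ca_const _ hA).
move=> t Dt; have -> : u t - (1 - q n t) = q n t - (1 - u t) by ring.
apply: le_trans (qd n t Dt) _.
have := dn n; have /andP[d0 d1] := d01 n; move: hn; rewrite ltr_pdivrMr // => hn.
move: (d n) (n%:R : R) hn d0 d1 => x m hn d0 d1 hx.
have [//|h] := lerP x e; nra.
Qed.

Lemma ca_geom x (q : R) : A x -> q < 1 -> (forall t, D t -> cabs (x t) <= q) ->
  A (fun t => (1 - x t)^-1).
Proof.
move=> Ax q1 xq; apply: (ca_lim _ hA) => e e0.
(* A point of [D] is needed to know [0 <= q]. *)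
have [[t0 Dt0]|noD] := pselect (exists t, D t); last first.
  by exists (fun _ => 0); [exact: (ca_const _ hA)|move=> t Dt; case: noD; exists t].
have q0 : 0 <= q by apply: le_trans (xq _ Dt0); apply: cabs_ge0.
have [n hn] := @expr_small R q (e * (1 - q)) q0 q1 ltac:(by rewrite mulr_gt0 ?subr_gt0).
exists (fun t => \sum_(i < n) x t ^+ i).
  by apply: ca_sum => i; apply: ca_exp.
move=> t Dt; have xt := xq t Dt.
have h : 1 - q <= cabs (1 - x t).
  have := cabsD (1 - x t) (x t); rewrite subrK cabs1; lra.
have h0 : 0 < cabs (1 - x t) by apply: lt_le_trans h; rewrite subr_gt0.
have nz : 1 - x t != 0 by rewrite -cabs_gt0.
have -> : (1 - x t)^-1 - \sum_(i < n) x t ^+ i = x t ^+ n / (1 - x t).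
  apply: (mulIf nz); rewrite mulfVK // mulrBl mulVf // [_ * (1 - _)]mulrC.
  by rewrite -(opprB (x t)) mulNr -subrX1; ring.
rewrite cabsM cabsV cabsX ler_pdivrMr //.
apply: le_trans (_ : q ^+ n <= _); first by apply: lerXn2r; rewrite ?nnegrE ?cabs_ge0.
by apply: le_trans hn _; rewrite ler_pM2l.
Qed.

(** Multiplication by [i] turns the half-plane [Im >= m] into [Re <= -m], so for small [s > 0] the
    values of [1 + i s c] lie in a disk about 0 of radius below 1. Then [ca_geom] inverts
    [-i s c]. *)
Lemma ca_inv c (m K : R) : A c -> 0 < m ->
  (forall t, D t -> m <= complex.Im (c t)) -> (forall t, D t -> cabs (c t) <= K) ->
  A (fun t => (c t)^-1).
Proof.
move=> Ac m0 hm hK.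
have [[t0 Dt0]|noD] := pselect (exists t, D t); last first.
  by apply: (ca_ext _ _ (ca_const _ hA 0)) => t Dt; case: noD; exists t.
have mK : m <= K.
  apply: le_trans (hm _ Dt0) _; apply: le_trans (hK _ Dt0).
  exact: le_trans (ler_norm _) (Im_le_cabs _).
have K0 : 0 < K by apply: lt_le_trans mK.
(* The minimizer of [1 - 2 s m + s^2 K^2], the bound for the squared modulus of [1 + i s c]; the
   minimum [1 - s m] is at most [(1 - s m / 2)^2]. *)
pose s : R := m / K ^+ 2.
have s0 : 0 < s by rewrite divr_gt0 // exprn_gt0.
have hq : 0 <= 1 - m * s / 2.
  have : m * s <= 1 by rewrite mulrA -expr2 ler_pdivrMr ?exprn_gt0 // mul1r; nra.
  lra.
pose x t := 1 + 'i * s%:C * c t.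
have Ax : A x.
  by apply: (ca_add _ hA); [exact: (ca_const _ hA)|exact: ca_scale].
have xb t : D t -> cabs (x t) <= 1 - m * s / 2.
  move=> Dt; apply: cabs_le_sqr => //.
  have h1 := hm t Dt.
  have h2 : cabs (c t) ^+ 2 <= K ^+ 2.
    by apply: lerXn2r; rewrite ?nnegrE ?cabs_ge0 ?(ltW K0) ?hK.
  rewrite cabs_sqr in h2.
  have -> : complex.Re (x t) = 1 - s * complex.Im (c t).
    by rewrite /x !ReImE; ring.
  have -> : complex.Im (x t) = s * complex.Re (c t).
    by rewrite /x !ReImE; ring.
  have h3 : s * (complex.Re (c t) ^+ 2 + complex.Im (c t) ^+ 2) <= m.
    by rewrite /s mulrAC ler_pdivrMr ?exprn_gt0 // ler_pM2l.
  have h4 : s * (s * (complex.Re (c t) ^+ 2 + complex.Im (c t) ^+ 2)) <= s * m.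
    by rewrite ler_pM2l.
  have h5 : s * m <= s * complex.Im (c t) by rewrite ler_pM2l.
  have h6 : 0 <= (m * s) ^+ 2 by rewrite sqr_ge0.
  nra.
have := ca_scale (- 'i * s%:C) _ (ca_geom _ _ Ax _ xb).
move=> /(_ ltac:(have := mulr_gt0 m0 s0; lra)) /ca_ext; apply.
move=> t Dt.
have c0 : c t != 0.
  by apply/eqP => ct0; have := hm t Dt; rewrite ct0 /= leNgt m0.
have sC : s%:C != 0 :> C by rewrite eq_complex /= gt_eqF.
have i0 : ('i : C) != 0 by rewrite -cabs_gt0 cabs_i.
have i2 := sqr_i R.
rewrite /x opprD addrA subrr add0r invrN !invfM.
rewrite mulrN !mulNr opprK.
by rewrite !mulrA [_ * 'i^-1]mulrAC mulfV // mul1r mulfV // mul1r.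
Qed.

End ClosedAlgebra.

(** * Bisection and boundary sums *)

Section SquareBisection.
Context {R : realType}.
Local Notation C := R[i].
Local Notation cabs := (@ComplexField.Normc.normc R).

Definition square (a : C) (s : R) (p : C) : Prop :=
  (complex.Re a <= complex.Re p <= complex.Re a + s) /\
  (complex.Im a <= complex.Im p <= complex.Im a + s).

Lemma nested_intervals (x s : nat -> R) :
  (forall n, 0 <= s n) -> (forall n, x n <= x n.+1) ->
  (forall n, x n.+1 + s n.+1 <= x n + s n) ->
  exists y, forall n, x n <= y <= x n + s n.
Proof.
move=> s0 xm ym.
have xle m n : (m <= n)%N -> x m <= x n.
  by move=> mn; rewrite -(subnK mn); elim: (n - m)%N => [|k IH]; rewrite ?lexx // addSn (le_trans IH).
have yle m n : (m <= n)%N -> x n + s n <= x m + s m.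
  by move=> mn; rewrite -(subnK mn); elim: (n - m)%N => [|k IH]; rewrite ?lexx // addSn (le_trans _ IH).
have cross m n : x m <= x n + s n.
  have [mn|/ltnW nm] := leqP m n.
    by apply: le_trans (xle _ _ mn) _; rewrite lerDl.
  by apply: le_trans (yle _ _ nm); rewrite lerDl.
pose S : set R := [set x n | n in setT]%classic.
have ubS n : (ubound S (x n + s n))%classic by move=> _ [m _ <-]; exact: cross.
exists (sup S) => n; apply/andP; split.
  by apply: ub_le_sup; [exists (x 0%N + s 0%N) => //; exact: ubS|exists n].
by apply: ge_sup; [exists (x 0%N); exists 0%N|exact: ubS].
Qed.

(** A square without [P] has a quarter without [P]; the nested bad squares shrink to a point, where
    the local hypothesis fails. All compactness arguments below go through this lemma. *)
Lemma square_bisection (P : C -> R -> Prop) (a0 : C) (s0 : R) : 0 < s0 ->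
  (forall (a : C) (s : R), 0 < s -> P a (s / 2) -> P (a + (s / 2)%:C) (s / 2) ->
     P (a + (s / 2)%:C * 'i) (s / 2) ->
     P (a + (s / 2)%:C + (s / 2)%:C * 'i) (s / 2) -> P a s) ->
  (forall p, square a0 s0 p -> exists2 d : R, 0 < d &
     forall a s, 0 < s -> s < d -> square a s p -> P a s) ->
  P a0 s0.
Proof.
move=> s0_gt0 her loc; apply: contrapT => nP.
(* Stated as an implication, so that choice yields a total function selecting a bad quarter. *)
pose good (x : C * R) (a' : C) := 0 < x.2 -> ~ P x.1 x.2 ->
  [/\ ~ P a' (x.2 / 2), complex.Re x.1 <= complex.Re a' <= complex.Re x.1 + x.2 / 2
    & complex.Im x.1 <= complex.Im a' <= complex.Im x.1 + x.2 / 2].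
have /choice [next hnext] : forall x, exists a', good x a'.
  move=> [a s]; apply: contrapT => /forallNP H.
  apply: (H a) => /= s_gt0 nPas; exfalso; apply: nPas.
  have hs : 0 <= s / 2 by rewrite divr_ge0 // ltW.
  have sub v : (0 <= complex.Re v <= s / 2) -> (0 <= complex.Im v <= s / 2) ->
      P (a + v) (s / 2).
    move=> hr hi; apply: contrapT => nPv; apply: (H (a + v)) => /= _ _.
    by split; rewrite /= ?ReD ?ImD; [exact: nPv|lra|lra].
  move: s_gt0 => /= s_gt0; apply: her => //=.
  - by rewrite -[a]addr0; apply: sub; rewrite /= lexx.
  - by apply: sub; rewrite /= ?lexx ?hs.
  - by apply: sub; rewrite !ReImE; lra.
  - by rewrite -addrA; apply: sub; rewrite !ReImE; lra.
pose s n : R := s0 / 2 ^+ n.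
pose u := fix u n := if n is n'.+1 then next (u n', s n') else a0.
have s_gt0 n : 0 < s n by rewrite divr_gt0 ?exprn_gt0.
have sS n : s n.+1 = s n / 2 by rewrite /s exprSr invfM mulrA.
have nPu n : ~ P (u n) (s n).
  elim: n => [|n IH]; first by rewrite /s expr0 divr1.
  by rewrite sS; have [] := hnext (u n, s n) (s_gt0 n) IH.
have ur n : complex.Re (u n) <= complex.Re (u n.+1) <= complex.Re (u n) + s n / 2.
  by have [] := hnext (u n, s n) (s_gt0 n) (nPu n).
have ui n : complex.Im (u n) <= complex.Im (u n.+1) <= complex.Im (u n) + s n / 2.
  by have [] := hnext (u n, s n) (s_gt0 n) (nPu n).
have [x hx] : exists y, forall n, complex.Re (u n) <= y <= complex.Re (u n) + s n.
  apply: nested_intervals => n; rewrite ?sS; first exact: ltW.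
  - by case/andP: (ur n).
  - by have := ur n; lra.
have [y hy] : exists y, forall n, complex.Im (u n) <= y <= complex.Im (u n) + s n.
  apply: nested_intervals => n; rewrite ?sS; first exact: ltW.
  - by case/andP: (ui n).
  - by have := ui n; lra.
have s0E : s 0%N = s0 by rewrite /s expr0 divr1.
have sq0 : square a0 s0 (x +i* y).
  by split; [have := hx 0%N|have := hy 0%N]; rewrite s0E.
have [d d0 hd] := loc _ sq0.
have d2 : 0 < d / (2 * s0) by rewrite divr_gt0 // mulr_gt0.
have [n hn] := @expr_small R 2^-1 _ ltac:(by lra) ltac:(by lra) d2.
have sqn : square (u n) (s n) (x +i* y) := conj (hx n) (hy n).
apply: (nPu n); apply: hd (s_gt0 n) _ sqn.
rewrite /s -exprVn; apply: le_lt_trans (_ : s0 * (d / (2 * s0)) < d).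
  by rewrite ler_pM2l.
rewrite invfM mulrCA [s0 * _]mulrC -mulrA mulVf ?gt_eqF // mulr1; lra.
Qed.

Lemma square_diam a s p q : square a s p -> square a s q -> cabs (p - q) <= 2 * s.
Proof.
move=> [pr pi] [qr qi]; apply: le_trans (cabs_le_ReIm _) _; rewrite !ReImE.
have h (x : R) : `|x| <= s = (- s <= x <= s) by rewrite ler_norml.
suff : `|complex.Re p - complex.Re q| <= s /\ `|complex.Im p - complex.Im q| <= s.
  by case; lra.
by rewrite !h; split; lra.
Qed.

Lemma square_cover a s p : square a s p ->
  [\/ square a (s / 2) p, square (a + (s / 2)%:C) (s / 2) p,
      square (a + (s / 2)%:C * 'i) (s / 2) p |
      square (a + (s / 2)%:C + (s / 2)%:C * 'i) (s / 2) p].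
Proof.
rewrite /square !ReImE => -[pr pi].
have [hr|hr] := lerP (complex.Re p) (complex.Re a + s / 2);
have [hi|hi] := lerP (complex.Im p) (complex.Im a + s / 2).
- by constructor 1; split; lra.
- by constructor 3; split; lra.
- by constructor 2; split; lra.
- by constructor 4; split; lra.
Qed.

End SquareBisection.

Section SquareSums.
Context {R : realType}.
Local Notation C := R[i].
Local Notation cabs := (@ComplexField.Normc.normc R).
Implicit Types (f g : C -> C) (a u : C) (s : R).

(** The left-endpoint Riemann sum for the integral of [f] along the segment from [a] to [a + u].
    With [2 ^ n] steps, halving the segment is an exact identity ([edge_sumS]). *)
Definition edge_sum (n : nat) f a u : C :=
  \sum_(k < 2 ^ n) f (a + k%:R * (u / (2 ^ n)%:R)) * (u / (2 ^ n)%:R).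

(* Opposite edges are sampled at the same parameters, so that interior edges
   cancel exactly in [square_sumS] and affine functions have boundary sum [0]. *)
Definition square_sum (n : nat) f a s : C :=
  edge_sum n f a s%:C - edge_sum n f (a + s%:C * 'i) s%:C
  + edge_sum n f (a + s%:C) (s%:C * 'i) - edge_sum n f a (s%:C * 'i).

Definition square_boundary a s (p : C) : Prop := exists2 t : R, 0 <= t <= 1 &
  [\/ p = a + t%:C * s%:C, p = a + s%:C * 'i + t%:C * s%:C,
      p = a + s%:C + t%:C * (s%:C * 'i) | p = a + t%:C * (s%:C * 'i)].

Lemma square_boundary_sub a s p : 0 < s -> square_boundary a s p -> square a s p.
Proof.
move=> s0 [t t01 h].
have ts : 0 <= t * s <= s by case/andP: t01 => *; apply/andP; split; nra.
rewrite /square; case: h => ->; rewrite !ReImE; split; lra.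
Qed.

Lemma edge_sumS n f a u : edge_sum n.+1 f a u =
  edge_sum n f a (u / 2%:R) + edge_sum n f (a + u / 2%:R) (u / 2%:R).
Proof.
have e2 : (2 ^ n)%:R != 0 :> C by rewrite pnatr_eq0 expn_eq0.
have -> : edge_sum n.+1 f a u = \sum_(k < 2 ^ n + 2 ^ n)
    f (a + k%:R * (u / 2%:R / (2 ^ n)%:R)) * (u / 2%:R / (2 ^ n)%:R).
  rewrite /edge_sum expnS mul2n -addnn; apply: eq_bigr => k _.
  have -> : u / (2 ^ n + 2 ^ n)%:R = u / 2%:R / (2 ^ n)%:R; last by [].
  by rewrite addnn -mul2n natrM invfM mulrA.
rewrite big_split_ord /=; congr (_ + _); rewrite /edge_sum.
apply: eq_bigr => k _; congr (f _ * _); rewrite natrD mulrDl addrA.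
by congr (a + _ + _); rewrite mulrC mulfVK.
Qed.

Lemma square_sumS n f a s : square_sum n.+1 f a s =
  square_sum n f a (s / 2) + square_sum n f (a + (s / 2)%:C) (s / 2)
  + square_sum n f (a + (s / 2)%:C * 'i) (s / 2)
  + square_sum n f (a + (s / 2)%:C + (s / 2)%:C * 'i) (s / 2).
Proof.
rewrite /square_sum !edge_sumS.
set h := (s / 2)%:C.
have hs : s%:C = h + h by rewrite /h -rmorphD /= -splitr.
have two0 : (2%:R : C) != 0 by rewrite pnatr_eq0.
have -> : s%:C / 2%:R = h by rewrite hs; field.
have -> : s%:C * 'i / 2%:R = h * 'i by rewrite hs; field.
rewrite hs.
have -> : a + (h + h) * 'i + h = a + h + h * 'i + h * 'i by ring.
have -> : a + (h + h) * 'i = a + h * 'i + h * 'i by ring.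
have -> : a + (h + h) + h * 'i = a + h + h * 'i + h by ring.
have -> : a + (h + h) = a + h + h by ring.
have -> : a + h * 'i + h = a + h + h * 'i by ring.
by ring.
Qed.

Lemma edge_sum_lin n (c : C) f g a u :
  edge_sum n (fun z => f z + c * g z) a u = edge_sum n f a u + c * edge_sum n g a u.
Proof.
rewrite /edge_sum mulr_sumr -big_split /=; apply: eq_bigr => k _ /=.
by ring.
Qed.

Lemma square_sum_lin n (c : C) f g a s :
  square_sum n (fun z => f z + c * g z) a s =
  square_sum n f a s + c * square_sum n g a s.
Proof. by rewrite /square_sum !edge_sum_lin; ring. Qed.

Lemma square_sumB n f g a s :
  square_sum n (fun z => f z - g z) a s = square_sum n f a s - square_sum n g a s.
Proof.
rewrite -[RHS]/(_ + _) -[X in _ + X]mulN1r -square_sum_lin.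
by congr square_sum; apply/funext => z; rewrite mulN1r.
Qed.

Lemma square_sum_affine n (b c : C) a s :
  square_sum n (fun z => b + c * z) a s = 0.
Proof.
have e2 : (2 ^ n)%:R != 0 :> C by rewrite pnatr_eq0 expn_eq0.
have shift a' v u : edge_sum n (fun z => b + c * z) (a' + v) u =
    edge_sum n (fun z => b + c * z) a' u + c * v * u.
  apply/eqP; rewrite -subr_eq0 opprD addrA -sumrB; apply/eqP.
  rewrite (eq_bigr (fun=> c * v * (u / (2 ^ n)%:R))); last by move=> k _; ring.
  by rewrite sumr_const card_ord -mulr_natr; field.
by rewrite /square_sum !shift; ring.
Qed.

Lemma edge_point n u (k : 'I_(2 ^ n)) : exists2 t : R, 0 <= t <= 1 &
  k%:R * (u / (2 ^ n)%:R) = t%:C * u.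
Proof.
have p0 : 0 < ((2 ^ n)%:R : R) by rewrite ltr0n expn_gt0.
exists (k%:R / (2 ^ n)%:R).
  by rewrite divr_ge0 //= ler_pdivrMr // mul1r ler_nat ltnW.
by rewrite rmorphM /= fmorphV /= !rmorph_nat mulrCA mulrC mulrAC.
Qed.

Lemma edge_sum_bound n f a u (M : R) :
  (forall t : R, 0 <= t <= 1 -> cabs (f (a + t%:C * u)) <= M) ->
  cabs (edge_sum n f a u) <= M * cabs u.
Proof.
move=> hM; apply: le_trans (cabs_sum _ _ _) _.
have p0 : ((2 ^ n)%:R : R) != 0 by rewrite pnatr_eq0 expn_eq0.
apply: le_trans (_ : \sum_(k < 2 ^ n) M * (cabs u / (2 ^ n)%:R) <= _).
  apply: ler_sum => k _; have [t t01 ->] := edge_point n u k.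
  rewrite cabsM [cabs (u / _)]cabsM cabsV cabs_nat.
  by apply: ler_wpM2r; [rewrite divr_ge0 ?cabs_ge0|exact: hM].
by rewrite sumr_const card_ord -[_ *+ _]mulr_natr -!mulrA mulVf // mulr1.
Qed.

Lemma square_sum_bound n f a s (M : R) : 0 < s ->
  (forall p, square_boundary a s p -> cabs (f p) <= M) ->
  cabs (square_sum n f a s) <= 4 * s * M.
Proof.
move=> s0 hM.
have cs : cabs s%:C = s by rewrite cabs_real gtr0_norm.
have csi : cabs (s%:C * 'i) = s by rewrite cabsM cabs_i mulr1.
have b1 : cabs (edge_sum n f a s%:C) <= M * s.
  by rewrite -{2}cs; apply: edge_sum_bound => t t01; apply: hM; exists t => //; constructor 1.
have b2 : cabs (edge_sum n f (a + s%:C * 'i) s%:C) <= M * s.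
  by rewrite -{3}cs; apply: edge_sum_bound => t t01; apply: hM; exists t => //; constructor 2.
have b3 : cabs (edge_sum n f (a + s%:C) (s%:C * 'i)) <= M * s.
  by rewrite -{3}csi; apply: edge_sum_bound => t t01; apply: hM; exists t => //; constructor 3.
have b4 : cabs (edge_sum n f a (s%:C * 'i)) <= M * s.
  by rewrite -{2}csi; apply: edge_sum_bound => t t01; apply: hM; exists t => //; constructor 4.
rewrite /square_sum; apply: le_trans (cabsB _ _) _.
have := cabsD (edge_sum n f a s%:C - edge_sum n f (a + s%:C * 'i) s%:C)
  (edge_sum n f (a + s%:C) (s%:C * 'i)).
have := cabsB (edge_sum n f a s%:C) (edge_sum n f (a + s%:C * 'i) s%:C).
lra.
Qed.

Lemma square_sum_eq n f g a s :
  (forall p, square_boundary a s p -> f p = g p) ->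
  square_sum n f a s = square_sum n g a s.
Proof.
move=> fg; rewrite /square_sum /edge_sum.
congr (_ - _ + _ - _); apply: eq_bigr => k _; congr (_ * _); apply: fg.
- by have [t t01 ->] := edge_point n s%:C k; exists t => //; constructor 1.
- by have [t t01 ->] := edge_point n s%:C k; exists t => //; constructor 2.
- by have [t t01 ->] := edge_point n (s%:C * 'i) k; exists t => //; constructor 3.
- by have [t t01 ->] := edge_point n (s%:C * 'i) k; exists t => //; constructor 4.
Qed.

End SquareSums.

(** * Goursat's theorem *)

Section Goursat.
Context {R : realType}.
Local Notation C := R[i].
Local Notation cabs := (@ComplexField.Normc.normc R).
Implicit Types (f : C -> C) (a e p z : C) (s : R).

Definition cdiff f p : Prop := exists c : C, forall e : R, 0 < e ->
  exists2 d : R, 0 < d & forall z, cabs (z - p) < d ->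
    cabs (f z - f p - c * (z - p)) <= e * cabs (z - p).

Definition ccont f p : Prop := forall e : R, 0 < e ->
  exists2 d : R, 0 < d & forall z, cabs (z - p) < d -> cabs (f z - f p) <= e.

(* A set function that is additive under quartering and at least [s] on a square
   of side [s] containing [e]: it absorbs the exceptional points, at which the
   boundary sum is only [o(s)]. It is a product of increments of the function
   [x |-> sign(x) sqrt|x|] (the square root of a negative number is [0]). *)
Definition sgn_sqrt (x : R) : R := Num.sqrt x - Num.sqrt (- x).

Definition point_charge e a s : R :=
  (sgn_sqrt (complex.Re a + s - complex.Re e) - sgn_sqrt (complex.Re a - complex.Re e)) *
  (sgn_sqrt (complex.Im a + s - complex.Im e) - sgn_sqrt (complex.Im a - complex.Im e)).

Lemma sgn_sqrt_le x y : x <= y -> sgn_sqrt x <= sgn_sqrt y.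
Proof.
move=> xy; rewrite /sgn_sqrt.
have h1 : Num.sqrt x <= Num.sqrt y by exact: ler_wsqrtr.
have h2 : Num.sqrt (- y) <= Num.sqrt (- x) by apply: ler_wsqrtr; rewrite lerN2.
lra.
Qed.

(** Across 0 the increment is [sqrt(x + s) + sqrt(-x)], so this is subadditivity of the square root.
    The product over the two coordinates gives the bound [s] of [point_charge_ge]. *)
Lemma sgn_sqrt_jump x s : 0 <= s -> x <= 0 <= x + s ->
  Num.sqrt s <= sgn_sqrt (x + s) - sgn_sqrt x.
Proof.
move=> s0 /andP[x0 xs]; rewrite /sgn_sqrt.
rewrite (@ler0_sqrtr _ x) // (@ler0_sqrtr _ (- (x + s))) ?oppr_le0 //.
rewrite subr0 sub0r opprK -(@ler_pXn2r _ 2) ?nnegrE ?addr_ge0 ?sqrtr_ge0 //.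
rewrite sqrrD !sqr_sqrtr ?oppr_ge0 //.
have : 0 <= Num.sqrt (x + s) * Num.sqrt (- x) by rewrite mulr_ge0 ?sqrtr_ge0.
lra.
Qed.

Lemma point_charge_ge0 e a s : 0 <= s -> 0 <= point_charge e a s.
Proof.
by move=> s0; apply: mulr_ge0; rewrite subr_ge0; apply: sgn_sqrt_le; lra.
Qed.

Lemma point_charge_ge e a s : 0 <= s -> square a s e -> s <= point_charge e a s.
Proof.
move=> s0 [er ei].
have h1 := sgn_sqrt_jump (complex.Re a - complex.Re e) s s0 ltac:(lra).
have h2 := sgn_sqrt_jump (complex.Im a - complex.Im e) s s0 ltac:(lra).
rewrite -{1}(sqr_sqrtr s0) expr2 /point_charge.
rewrite (addrAC (complex.Re a)) (addrAC (complex.Im a)).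
by apply: ler_pM; rewrite ?sqrtr_ge0.
Qed.

Lemma point_charge_split e a s : point_charge e a s =
  point_charge e a (s / 2) + point_charge e (a + (s / 2)%:C) (s / 2)
  + point_charge e (a + (s / 2)%:C * 'i) (s / 2)
  + point_charge e (a + (s / 2)%:C + (s / 2)%:C * 'i) (s / 2).
Proof.
rewrite /point_charge !ReImE.
rewrite !(mulr0, mul0r, mulr1, addr0, add0r, subr0).
by rewrite -!(addrA _ (s / 2) (s / 2)) -splitr; ring.
Qed.

(** The weight [W] is additive under quartering, like the boundary sums, so a bound by [eta * W]
    need only be checked on small squares. The area in [W] pays for points of differentiability,
    where the sum is [o(s^2)], and the charges pay for the points of [E], where continuity gives
    only [o(s)]. *)
Lemma goursat f a0 (s0 : R) (E : seq C) : 0 < s0 ->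
  (forall p, square a0 s0 p -> p \notin E -> cdiff f p) ->
  (forall p, square a0 s0 p -> p \in E -> ccont f p) ->
  forall eps : R, 0 < eps -> exists N, forall n, (N <= n)%N ->
    cabs (square_sum n f a0 s0) <= eps.
Proof.
move=> s0_gt0 hdiff hcont eps eps0.
pose W a s : R := s ^+ 2 + \sum_(e <- E) point_charge e a s.
have W_split a s : W a s = W a (s / 2) + W (a + (s / 2)%:C) (s / 2)
    + W (a + (s / 2)%:C * 'i) (s / 2) + W (a + (s / 2)%:C + (s / 2)%:C * 'i) (s / 2).
  rewrite /W (eq_bigr _ (fun e _ => point_charge_split e a s)) !big_split /=.
  by field.
have sum_ge0 a s : 0 <= s -> 0 <= \sum_(e <- E) point_charge e a s.
  by move=> s1; apply: sumr_ge0 => e _; apply: point_charge_ge0.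
have W0 : 0 < W a0 s0.
  by apply: ltr_wpDr; [apply: sum_ge0; exact: ltW|rewrite exprn_gt0].
pose eta := eps / W a0 s0.
have eta0 : 0 < eta by rewrite divr_gt0.
suff : exists N, forall n, (N <= n)%N ->
    cabs (square_sum n f a0 s0) <= eta * W a0 s0.
  by rewrite /eta mulfVK // gt_eqF.
pose P a s := exists N, forall n, (N <= n)%N -> cabs (square_sum n f a s) <= eta * W a s.
apply: (square_bisection P) => // [a s sp|p sqp].
  move=> [N1 h1] [N2 h2] [N3 h3] [N4 h4].
  (* The successor is the dyadic level that [square_sumS] spends on the quartering. *)
  exists (maxn (maxn N1 N2) (maxn N3 N4)).+1 => -[|n] //.
  rewrite ltnS !geq_max => /andP[/andP[n1 n2] /andP[n3 n4]].
  rewrite square_sumS W_split 3!mulrDr.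
  apply: le_trans (cabsD _ _) (lerD _ (h4 _ n4)).
  apply: le_trans (cabsD _ _) (lerD _ (h3 _ n3)).
  exact: le_trans (cabsD _ _) (lerD (h1 _ n1) (h2 _ n2)).
have [pE|pE] := boolP (p \in E).
  have [d d0 hd] := hcont p sqp pE (eta / 4) ltac:(by rewrite divr_gt0).
  exists (d / 2) => [|a s sp sd pas]; first by rewrite divr_gt0.
  exists 0%N => n _.
  have -> : square_sum n f a s = square_sum n (fun z => f z - (f p + 0 * z)) a s.
    by rewrite square_sumB square_sum_affine subr0.
  apply: le_trans (_ : 4 * s * (eta / 4) <= _).
    apply: square_sum_bound => // z /(square_boundary_sub _ _ _ sp) hz.
    rewrite mul0r addr0; apply: hd.
    by apply: le_lt_trans (square_diam _ _ _ _ hz pas) _; lra.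
  rewrite (_ : 4 * s * (eta / 4) = eta * s); last by field.
  apply: ler_wpM2l; first exact: ltW.
  have := point_charge_ge p a s (ltW sp) pas => h.
  apply: le_trans h _; rewrite /W (big_rem p) //=.
  have : 0 <= \sum_(e <- rem p E) point_charge e a s.
    by apply: sumr_ge0 => e _; apply: point_charge_ge0; exact: ltW.
  have := sqr_ge0 s; lra.
have [c hc] := hdiff p sqp pE.
have [d d0 hd] := hc (eta / 8) ltac:(by rewrite divr_gt0).
exists (d / 2) => [|a s sp sd pas]; first by rewrite divr_gt0.
exists 0%N => n _.
have -> : square_sum n f a s =
    square_sum n (fun z => f z - ((f p - c * p) + c * z)) a s.
  by rewrite square_sumB square_sum_affine subr0.
apply: le_trans (_ : 4 * s * (eta / 8 * (2 * s)) <= _).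
  apply: square_sum_bound => // z /(square_boundary_sub _ _ _ sp) hz.
  have hzp := square_diam _ _ _ _ hz pas.
  have -> : f z - (f p - c * p + c * z) = f z - f p - c * (z - p) by ring.
  apply: le_trans (hd z _) _; first by apply: le_lt_trans hzp _; lra.
  by apply: ler_wpM2l => //; rewrite ltW // divr_gt0.
rewrite (_ : 4 * s * (eta / 8 * (2 * s)) = eta * s ^+ 2); last by field.
apply: ler_wpM2l; first exact: ltW.
by rewrite lerDl; apply: sum_ge0; exact: ltW.
Qed.

End Goursat.

(** * Cauchy's formula *)

Section Cauchy.
Context {R : realType}.
Local Notation C := R[i].
Local Notation cabs := (@ComplexField.Normc.normc R).
Implicit Types (f : C -> C) (p z w : C).

Definition diff_quotient f z (c : C) (x : C) : C :=
  if x == z then c else (f x - f z) / (x - z).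

Lemma away_from p z x : cabs (x - p) < cabs (p - z) / 2 -> cabs (p - z) / 2 <= cabs (x - z).
Proof.
by have := cabs_tri x p z; rewrite (cabs_sub p x); lra.
Qed.

Lemma diff_quotient_ccont_center f z c :
  (forall e : R, 0 < e -> exists2 d : R, 0 < d & forall x, cabs (x - z) < d ->
    cabs (f x - f z - c * (x - z)) <= e * cabs (x - z)) ->
  ccont (diff_quotient f z c) z.
Proof.
move=> hc e e0; have [d d0 hd] := hc e e0; exists d => // x xd.
rewrite /diff_quotient eqxx; have [xz|xz] := eqVneq x z.
  by rewrite subrr cabs0 ltW.
have nz : x - z != 0 by rewrite subr_eq0.
have -> : (f x - f z) / (x - z) - c = (f x - f z - c * (x - z)) / (x - z) by field.
by rewrite cabsM cabsV ler_pdivrMr ?cabs_gt0 //; apply: hd.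
Qed.

Lemma diff_quotient_ccont f z c p : p != z -> ccont f p ->
  ccont (diff_quotient f z c) p.
Proof.
move=> pz hf e e0.
have pz0 : p - z != 0 by rewrite subr_eq0.
pose L := cabs (p - z); have L0 : 0 < L by rewrite cabs_gt0.
have [d d0 hd] := hf (e * L / 4) ltac:(by rewrite !mulr_gt0 // invr_gt0).
(* Within distance [b] the term [(f p - f z) / (p - z) * (x - p)] stays below [e * L / 4]; the [+ 1]
   keeps [K] positive. *)
pose K := cabs (f p - f z) + 1; have K0 : 0 < K by rewrite /K; have := cabs_ge0 (f p - f z); lra.
pose b := e * L ^+ 2 / (4 * K).
have b0 : 0 < b by rewrite divr_gt0 ?mulr_gt0 ?exprn_gt0.
exists (Num.min d (Num.min (L / 2) b)) => [|x].
  by rewrite !lt_min d0 b0 divr_gt0.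
rewrite !lt_min => /and3P[xd xL xb].
have xz := away_from _ _ _ xL; rewrite -/L in xz.
have xz0 : x - z != 0 by rewrite -cabs_gt0; lra.
have xnz : x != z by rewrite -subr_eq0.
rewrite /diff_quotient (negbTE pz) (negbTE xnz).
have -> : (f x - f z) / (x - z) - (f p - f z) / (p - z) =
  ((f x - f p) - (f p - f z) / (p - z) * (x - p)) / (x - z) by field; rewrite xz0.
rewrite cabsM cabsV ler_pdivrMr ?cabs_gt0 //.
apply: le_trans (_ : e * (L / 2) <= _); last by rewrite ler_pM2l.
apply: le_trans (cabsB _ _) _; rewrite !cabsM cabsV -/L.
have h1 := hd x xd.
have h2 : cabs (f p - f z) / L * cabs (x - p) <= e * L / 4.
  apply: le_trans (_ : K / L * b <= _).
    apply: ler_pM; rewrite ?cabs_ge0 ?divr_ge0 ?cabs_ge0 //; last exact: ltW.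
    by rewrite ler_pM2r ?invr_gt0 // /K lerDl.
  by rewrite /b le_eqVlt; apply/orP; left; apply/eqP; field; rewrite !gt_eqF.
lra.
Qed.

Lemma diff_quotient_cdiff f z c p : p != z -> cdiff f p ->
  cdiff (diff_quotient f z c) p.
Proof.
move=> pz [al hal].
have pz0 : p - z != 0 by rewrite subr_eq0.
pose L := cabs (p - z); have L0 : 0 < L by rewrite cabs_gt0.
(* The quotient rule. With [G] the error is an exact expression, whose part quadratic in [x - p] is
   controlled by [b]. *)
exists ((al * (p - z) - (f p - f z)) / (p - z) ^+ 2) => e e0.
have [d d0 hd] := hal (e * L / 4) ltac:(by rewrite !mulr_gt0 // invr_gt0).
pose G := f p - f z - al * (p - z).
pose K := cabs G + 1; have K0 : 0 < K by rewrite /K; have := cabs_ge0 G; lra.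
pose b := e * L ^+ 3 / (4 * K).
have b0 : 0 < b by rewrite divr_gt0 ?mulr_gt0 ?exprn_gt0.
exists (Num.min d (Num.min (L / 2) b)) => [|x].
  by rewrite !lt_min d0 b0 divr_gt0.
rewrite !lt_min => /and3P[xd xL xb].
have xz := away_from _ _ _ xL; rewrite -/L in xz.
have xz0 : x - z != 0 by rewrite -cabs_gt0; lra.
have xnz : x != z by rewrite -subr_eq0.
rewrite /diff_quotient (negbTE pz) (negbTE xnz).
have -> : (f x - f z) / (x - z) - (f p - f z) / (p - z) -
    (al * (p - z) - (f p - f z)) / (p - z) ^+ 2 * (x - p) =
  ((f x - f p - al * (x - p)) + G / (p - z) ^+ 2 * (x - p) * (x - p)) / (x - z).
  by rewrite /G; field; rewrite xz0.
rewrite cabsM cabsV ler_pdivrMr ?cabs_gt0 //.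
apply: le_trans (_ : e * cabs (x - p) * (L / 2) <= _); last first.
  by apply: ler_wpM2l => //; rewrite mulr_ge0 ?cabs_ge0 // ltW.
apply: le_trans (cabsD _ _) _; rewrite !cabsM cabsV cabsX -/L.
have h1 := hd x xd.
have h2 : cabs G / L ^+ 2 * cabs (x - p) * cabs (x - p) <= e * L / 4 * cabs (x - p).
  apply: ler_wpM2r; first exact: cabs_ge0.
  apply: le_trans (_ : K / L ^+ 2 * b <= _).
    apply: ler_pM; rewrite ?cabs_ge0 ?divr_ge0 ?cabs_ge0 ?exprn_ge0 //; try exact: ltW.
    by rewrite ler_pM2r ?invr_gt0 ?exprn_gt0 // /K lerDl.
  by rewrite /b le_eqVlt; apply/orP; left; apply/eqP; field; rewrite !gt_eqF.
lra.
Qed.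

Definition csquare (r : R) p : Prop := `|complex.Re p| <= r /\ `|complex.Im p| <= r.
Definition corner (r : R) : C := - (r%:C + r%:C * 'i).

Lemma csquareP (r : R) p : csquare r p <-> square (corner r) (2 * r) p.
Proof.
rewrite /csquare /square /corner !ReImE !ler_norml.
rewrite !(mulr0, mul0r, mulr1, addr0, add0r, subr0).
by split=> -[h1 h2]; split; lra.
Qed.

Lemma cabs_csquare (r : R) p : csquare r p -> cabs p <= 2 * r.
Proof. by move=> [h1 h2]; apply: le_trans (cabs_le_ReIm _) _; lra. Qed.

Lemma csquare_cabs (r : R) p : cabs p <= r -> csquare r p.
Proof.
by move=> h; split; apply: le_trans h; [exact: Re_le_cabs|exact: Im_le_cabs].
Qed.

Context (r : R) (r0 : 0 < r).
Local Notation B n f := (square_sum n f (corner r) (2 * r)).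
Local Notation bdry := (square_boundary (corner r) (2 * r)).

Lemma two_r_gt0 : 0 < 2 * r.
Proof. by rewrite mulr_gt0. Qed.

Lemma csquare_half z : csquare (r / 2) z -> csquare r z.
Proof. by have rp := r0; move=> [h1 h2]; split; lra. Qed.

Lemma bdry_csquare p : bdry p -> csquare r p.
Proof. by move=> /(square_boundary_sub _ _ _ two_r_gt0) /csquareP. Qed.

Lemma bdry_dist p z : csquare (r / 2) z -> bdry p -> r / 2 <= cabs (p - z).
Proof.
have rp := r0; move=> [zr zi] [t t01 hp].
have [|] : (r / 2 <= `|complex.Im (p - z)|) \/ (r / 2 <= `|complex.Re (p - z)|).
  move: zr zi; rewrite !ler_norml => zr zi.
  rewrite !ler_normr.
  case: hp => ->; rewrite /corner !ReImE;
    rewrite !(mulr0, mul0r, mulr1, addr0, add0r, subr0).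
  - by left; apply/orP; right; lra.
  - by left; apply/orP; left; lra.
  - by right; apply/orP; left; lra.
  - by right; apply/orP; right; lra.
- by move=> h; apply: le_trans h (Im_le_cabs _).
- by move=> h; apply: le_trans h (Re_le_cabs _).
Qed.

Lemma bdry_neq p z : csquare (r / 2) z -> bdry p -> p != z.
Proof.
have rp := r0; move=> hz hp; rewrite -subr_eq0 -cabs_gt0.
by apply: lt_le_trans (bdry_dist _ _ hz hp); rewrite divr_gt0.
Qed.

(** The Riemann sum of the integral of [1/(x - z)], a stand-in for 2 pi i of which only [winding_le]
    and [winding_Im] are used. *)
Definition winding n z : C := B n (fun x => (x - z)^-1).

Lemma winding_le n z : csquare (r / 2) z -> cabs (winding n z) <= 16.
Proof.
have rp := r0; move=> hz; apply: le_trans (_ : 4 * (2 * r) * (2 / r) <= _).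
  apply: square_sum_bound; first exact: two_r_gt0.
  move=> p hp; rewrite cabsV -[2 / r]invrK invf_div lef_pV2 ?posrE ?divr_gt0 //.
    exact: bdry_dist.
  by rewrite cabs_gt0 subr_eq0 bdry_neq.
by rewrite le_eqVlt; apply/orP; left; apply/eqP; field; rewrite gt_eqF.
Qed.

Lemma edge_sum_Im_ge n f a u (sg m : R) :
  (forall t : R, 0 <= t <= 1 -> m <= sg * complex.Im (f (a + t%:C * u) * u)) ->
  m <= sg * complex.Im (edge_sum n f a u).
Proof.
have rp := r0; move=> h; rewrite /edge_sum.
have p0 : ((2 ^ n)%:R : R) != 0 by rewrite pnatr_eq0 expn_eq0.
have -> : complex.Im (\sum_(k < 2 ^ n) f (a + k%:R * (u / (2 ^ n)%:R)) * (u / (2 ^ n)%:R)) =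
  \sum_(k < 2 ^ n) complex.Im (f (a + k%:R * (u / (2 ^ n)%:R)) * u) / (2 ^ n)%:R.
  elim/big_rec2: _ => [|k x y _ <-] //; rewrite ImD; congr (_ + _).
  rewrite mulrA; set v := _ * u.
  have -> : (2 ^ n)%:R^-1 = ((2 ^ n)%:R^-1 : R)%:C by rewrite fmorphV rmorph_nat.
  by rewrite ImM Re_real Im_real mulr0 add0r.
rewrite mulr_sumr; apply: le_trans (_ : \sum_(k < 2 ^ n) m / (2 ^ n)%:R <= _).
  by rewrite sumr_const card_ord -[_ *+ _]mulr_natr mulfVK.
apply: ler_sum => k _; have [t t01 ->] := edge_point n u k.
rewrite mulrA; apply: ler_wpM2r; last exact: h.
by rewrite invr_ge0.
Qed.

Lemma Im_divc (u x : C) : complex.Im (x^-1 * u) =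
  (complex.Re x * complex.Im u - complex.Im x * complex.Re u) / cabs x ^+ 2.
Proof. by rewrite cabs_sqr; case: x u => a b [c d] /=; ring. Qed.

(** Every edge turns counterclockwise around [z]: the cross product of [p - z] with the edge is a
    distance of at least [r/2] times the length [2 r], while [|p - z| <= 3 r]. So each edge
    contributes at least 1/9, and the four together 4/9. *)
Lemma winding_Im n z : csquare (r / 2) z -> 1 / 3 <= complex.Im (winding n z).
Proof.
have rp := r0; move=> hz; rewrite /winding /square_sum.
have main sg (u p : C) : bdry p ->
    r ^+ 2 <= sg * (complex.Re (p - z) * complex.Im u - complex.Im (p - z) * complex.Re u) ->
    1 / 9 <= sg * complex.Im ((p - z)^-1 * u).
  move=> hp h; rewrite Im_divc mulrA.
  have c0 : 0 < cabs (p - z) by rewrite cabs_gt0 subr_eq0 bdry_neq.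
  rewrite ler_pdivlMr ?exprn_gt0 //; apply: le_trans h.
  have h3 : cabs (p - z) <= 3 * r.
    apply: le_trans (cabsB _ _) _.
    have := cabs_csquare _ _ hz; have := cabs_csquare _ _ (bdry_csquare _ hp); lra.
  have : cabs (p - z) ^+ 2 <= (3 * r) ^+ 2.
    by apply: lerXn2r; rewrite ?nnegrE ?cabs_ge0 // mulr_ge0 // ltW.
  lra.
have [zr zi] := hz; move: zr zi; rewrite !ler_norml => zr zi.
rewrite ImD [complex.Im (_ + edge_sum _ _ _ _)]ImD ImD !ImN.
have e1 : 1 / 9 <= 1 * complex.Im (edge_sum n (fun x => (x - z)^-1) (corner r) (2 * r)%:C).
  apply: edge_sum_Im_ge => t t01; apply: main; first by exists t => //; constructor 1.
  by rewrite /corner !ReImE; nra.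
have e2 : 1 / 9 <= -1 * complex.Im (edge_sum n (fun x => (x - z)^-1)
    (corner r + (2 * r)%:C * 'i) (2 * r)%:C).
  apply: edge_sum_Im_ge => t t01; apply: main; first by exists t => //; constructor 2.
  by rewrite /corner !ReImE; nra.
have e3 : 1 / 9 <= 1 * complex.Im (edge_sum n (fun x => (x - z)^-1)
    (corner r + (2 * r)%:C) ((2 * r)%:C * 'i)).
  apply: edge_sum_Im_ge => t t01; apply: main; first by exists t => //; constructor 3.
  by rewrite /corner !ReImE; nra.
have e4 : 1 / 9 <= -1 * complex.Im (edge_sum n (fun x => (x - z)^-1)
    (corner r) ((2 * r)%:C * 'i)).
  apply: edge_sum_Im_ge => t t01; apply: main; first by exists t => //; constructor 4.
  by rewrite /corner !ReImE; nra.
lra.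
Qed.

(** Cauchy's formula as a smallness statement: [goursat] for the difference quotient, with [z] added
    to the exceptional points. The boundary avoids [z], so the value [c] disappears from the sum. *)
Lemma cauchy_sum f (E : seq C) z : csquare (r / 2) z -> z \notin E ->
  (forall p, csquare r p -> p \notin E -> cdiff f p) ->
  (forall p, csquare r p -> p \in E -> ccont f p) ->
  forall e : R, 0 < e -> exists N, forall n, (N <= n)%N ->
    cabs (B n (fun x => (f x - f z) / (x - z))) <= e.
Proof.
have rp := r0; move=> hz zE hd hc e e0.
have hzr := csquare_half _ hz.
have [c hcz] := hd z hzr zE.
have [N hN] : exists N, forall n, (N <= n)%N -> cabs (B n (diff_quotient f z c)) <= e.
  apply: (goursat _ _ _ (z :: E)) => // [|p sp|p sp]; first exact: two_r_gt0.
    rewrite inE negb_or => /andP[pz pE].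
    by apply: diff_quotient_cdiff => //; apply: hd => //; apply/csquareP.
  rewrite inE => pzE; have [->|pz] := eqVneq p z.
    exact: diff_quotient_ccont_center.
  apply: diff_quotient_ccont => //; apply: hc; first exact/csquareP.
  by move: pzE; rewrite (negbTE pz).
exists N => n /hN; rewrite (square_sum_eq n _ (fun x => (f x - f z) / (x - z))) //.
by move=> p hp; rewrite /diff_quotient (negbTE (bdry_neq _ _ hz hp)).
Qed.

(** Perimeter [8 r] times [2/r] bounds the sum of [f x / (x - z)] by [16 M]; dividing by a winding
    sum of modulus at least 1/3 gives [48 M]. *)
Lemma cauchy_bound f (E : seq C) z (M : R) : csquare (r / 2) z -> z \notin E ->
  (forall p, csquare r p -> p \notin E -> cdiff f p) ->
  (forall p, csquare r p -> p \in E -> ccont f p) ->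
  (forall p, bdry p -> cabs (f p) <= M) -> cabs (f z) <= 48 * M.
Proof.
have rp := r0; move=> hz zE hd hc hM; apply/ler_addgt0Pr => e e0.
have [N hN] := cauchy_sum _ _ _ hz zE hd hc (e / 3) ltac:(by rewrite divr_gt0).
have := hN N (leqnn _).
rewrite (square_sum_eq _ _ (fun x => f x / (x - z) + (- f z) * (x - z)^-1)); last first.
  by move=> p _; ring.
rewrite square_sum_lin -/(winding N z) => h.
have h1 : cabs (B N (fun x => f x / (x - z))) <= 4 * (2 * r) * (M * (2 / r)).
  apply: square_sum_bound; first exact: two_r_gt0.
  move=> p hp; rewrite cabsM cabsV; apply: ler_pM; rewrite ?invr_ge0 ?cabs_ge0 //.
    exact: hM.
  rewrite -[2 / r]invrK invf_div lef_pV2 ?posrE ?divr_gt0 //; first exact: bdry_dist.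
  by rewrite cabs_gt0 subr_eq0 bdry_neq.
have h2 : 4 * (2 * r) * (M * (2 / r)) = 16 * M by field; rewrite gt_eqF.
have h3 : cabs (f z) * cabs (winding N z) <= 16 * M + e / 3.
  rewrite -cabsM; have := cabsD (- (B N (fun x => f x / (x - z)) + - f z * winding N z))
    (B N (fun x => f x / (x - z))).
  rewrite cabsN (_ : - _ + _ = f z * winding N z); last by ring.
  lra.
have h4 : 1 / 3 <= cabs (winding N z).
  by apply: le_trans (winding_Im N _ hz) _; apply: le_trans (ler_norm _) (Im_le_cabs _).
have := cabs_ge0 (f z); nra.
Qed.

(** [cauchy_bound] for the difference quotient at [w], with [w] as the exceptional point. On the
    boundary that quotient is at most [2 M / (r/2)], and [48 * 4 = 192]. *)
Lemma cauchy_lipschitz f (M : R) : (forall p, csquare r p -> cdiff f p) ->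
  (forall p, csquare r p -> cabs (f p) <= M) ->
  forall z w, csquare (r / 2) z -> csquare (r / 2) w ->
    cabs (f z - f w) <= 192 * M / r * cabs (z - w).
Proof.
have rp := r0; move=> hd hM z w hz hw.
have [->|zw] := eqVneq z w; first by rewrite !subrr cabs0 mulr0.
have hwr := csquare_half _ hw.
have [c hcw] := hd w hwr.
have zw0 : z - w != 0 by rewrite subr_eq0.
suff : cabs (diff_quotient f w c z) <= 48 * (4 * M / r).
  rewrite /diff_quotient (negbTE zw) cabsM cabsV ler_pdivrMr ?cabs_gt0 //.
  by rewrite (_ : 48 * (4 * M / r) = 192 * M / r) //; field; rewrite gt_eqF.
apply: (cauchy_bound _ [:: w]) => //; first by rewrite inE.
- move=> p hp; rewrite inE => pw; apply: diff_quotient_cdiff => //; exact: hd.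
- by move=> p hp; rewrite inE => /eqP ->; apply: diff_quotient_ccont_center.
move=> p hp; rewrite /diff_quotient (negbTE (bdry_neq _ _ hw hp)) cabsM cabsV.
rewrite ler_pdivrMr ?cabs_gt0 ?subr_eq0 ?bdry_neq //.
have h1 := hM p (bdry_csquare _ hp); have h2 := hM w hwr.
have h3 := bdry_dist _ _ hw hp.
have M0 : 0 <= M by apply: le_trans h2; exact: cabs_ge0.
apply: le_trans (cabsB _ _) _.
apply: le_trans (_ : 4 * M / r * (r / 2) <= _); last first.
  by apply: ler_wpM2l => //; rewrite divr_ge0 ?mulr_ge0 // ltW.
rewrite (_ : 4 * M / r * (r / 2) = 2 * M); last by field; rewrite gt_eqF.
lra.
Qed.

End Cauchy.

(** * Functions of two variables *)

Section TwoVariables.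
Context {R : realType}.
Local Notation C := R[i].
Local Notation cabs := (@ComplexField.Normc.normc R).

(** A Lebesgue number argument: the four radii found on the quarters are replaced by their minimum,
    which is allowed because [P] survives shrinking of [d]. *)
Lemma square_compact (P : R -> C -> Prop) (a0 : C) (s0 : R) : 0 < s0 ->
  (forall d d' x, 0 < d' -> d' <= d -> P d x -> P d' x) ->
  (forall p, square a0 s0 p -> exists2 d : R, 0 < d &
     forall x, cabs (x - p) < d -> square a0 s0 x -> P d x) ->
  exists2 d : R, 0 < d & forall x, square a0 s0 x -> P d x.
Proof.
move=> s00 mono loc.
(* The doubled hypothesis lets [Q] speak of arbitrary squares, including those that leave the
   initial one. *)
suff : exists2 d : R, 0 < d & forall x, square a0 s0 x -> square a0 s0 x -> P d x.
  by move=> [d d0 h]; exists d => // x hx; exact: h.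
pose Q a s := exists2 d : R, 0 < d & forall x, square a s x -> square a0 s0 x -> P d x.
apply: (square_bisection Q) => // [a s sp|p hp].
  move=> [d1 d10 h1] [d2 d20 h2] [d3 d30 h3] [d4 d40 h4].
  exists (Num.min (Num.min d1 d2) (Num.min d3 d4)); first by rewrite !lt_min d10 d20 d30.
  move=> x /square_cover hx x0; have := hx; case=> {}hx.
  - by apply: mono (h1 _ hx x0); rewrite ?lt_min ?d10 ?d20 ?d30 // !ge_min lexx.
  - by apply: mono (h2 _ hx x0); rewrite ?lt_min ?d10 ?d20 ?d30 // !ge_min lexx orbT.
  - by apply: mono (h3 _ hx x0); rewrite ?lt_min ?d10 ?d20 ?d30 // !ge_min lexx !orbT.
  - by apply: mono (h4 _ hx x0); rewrite ?lt_min ?d10 ?d20 ?d30 // !ge_min lexx !orbT.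
have [d d0 hd] := loc p hp; exists (d / 2) => [|a s sp sd pas]; first by rewrite divr_gt0.
exists d => // x hx; apply: hd.
by apply: le_lt_trans (square_diam _ _ _ _ hx pas) _; lra.
Qed.

Definition hol2_at (F : C -> C -> C) p1 p2 := exists a b : C,
  forall e : R, 0 < e -> exists2 d : R, 0 < d &
    forall h1 h2, cnorm2 h1 h2 < d ->
      cabs (F (p1 + h1) (p2 + h2) - F p1 p2 - a * h1 - b * h2) <= e * cnorm2 h1 h2.

Lemma cnorm2_lt (x y : C) (d : R) : cnorm2 x y < d = (cabs x < d) && (cabs y < d).
Proof. exact: gt_max. Qed.

Lemma hol2_cdiff1 F p1 p2 : hol2_at F p1 p2 -> cdiff (F ^~ p2) p1.
Proof.
move=> [a [b hF]]; exists a => e e0; have [d d0 hd] := hF e e0; exists d => // x hx.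
have n0 : cnorm2 (x - p1) 0 = cabs (x - p1).
  by rewrite /cnorm2 cabs0; apply/max_idPl; exact: cabs_ge0.
have := hd (x - p1) 0; rewrite n0 mulr0 subr0 addr0 [p1 + _]addrC subrK; exact.
Qed.

Lemma hol2_swap F p1 p2 : hol2_at F p1 p2 -> hol2_at (fun x y => F y x) p2 p1.
Proof.
move=> [a [b hF]]; exists b, a => e e0; have [d d0 hd] := hF e e0; exists d => // h1 h2.
have -> : cnorm2 h1 h2 = cnorm2 h2 h1 by rewrite /cnorm2 maxC.
by move=> /hd; congr (cabs _ <= _); ring.
Qed.

(** Lets [cauchy_sum_uniform] serve for functions of one variable in [hol2_in_algebra]. *)
Lemma hol2_fst (f : C -> C) p1 p2 : cdiff f p1 -> hol2_at (fun x _ => f x) p1 p2.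
Proof.
move=> [a hf]; exists a, 0 => e e0; have [d d0 hd] := hf e e0; exists d => // h1 h2.
rewrite cnorm2_lt => /andP[h1d _].
have := hd (p1 + h1); rewrite [p1 + h1]addrC addrK mul0r subr0 => /(_ h1d) h.
by apply: le_trans h _; apply: ler_wpM2l; rewrite ?(ltW e0) // le_max lexx.
Qed.

Lemma hol2_continuous F p1 p2 : hol2_at F p1 p2 -> forall e : R, 0 < e ->
  exists2 d : R, 0 < d & forall x y, cabs (x - p1) < d -> cabs (y - p2) < d ->
    cabs (F x y - F p1 p2) <= e.
Proof.
move=> [a [b hF]] e e0; have [d d0 hd] := hF 1 ltr01.
pose K := 1 + cabs a + cabs b.
have K0 : 0 < K by rewrite /K; have := cabs_ge0 a; have := cabs_ge0 b; lra.
exists (Num.min d (e / K)) => [|x y]; first by rewrite lt_min d0 divr_gt0.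
rewrite !lt_min => /andP[xd xe] /andP[yd ye].
have := hd (x - p1) (y - p2); rewrite cnorm2_lt xd yd mul1r => /(_ isT).
rewrite [p1 + _]addrC [p2 + _]addrC !subrK => h.
have hm : cnorm2 (x - p1) (y - p2) <= e / K by rewrite ge_max !ltW.
rewrite ler_pdivlMr // in hm.
have ha : cabs (x - p1) <= cnorm2 (x - p1) (y - p2) by rewrite le_max lexx.
have hb : cabs (y - p2) <= cnorm2 (x - p1) (y - p2) by rewrite le_max lexx orbT.
have -> : F x y - F p1 p2 = (F x y - F p1 p2 - a * (x - p1) - b * (y - p2)) +
  a * (x - p1) + b * (y - p2) by ring.
apply: le_trans (cabsD _ _) _; rewrite cabsM.
have := cabsD (F x y - F p1 p2 - a * (x - p1) - b * (y - p2)) (a * (x - p1)).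
rewrite cabsM.
have := ler_wpM2l (cabs_ge0 a) ha; have := ler_wpM2l (cabs_ge0 b) hb.
rewrite /K in hm; lra.
Qed.

Context (r : R) (r0 : 0 < r).
Local Notation B n f := (square_sum n f (corner r) (2 * r)).
Local Notation bdry := (square_boundary (corner r) (2 * r)).

Lemma csquare_compact (s : R) (P : R -> C -> Prop) : 0 < s ->
  (forall d d' x, 0 < d' -> d' <= d -> P d x -> P d' x) ->
  (forall p, csquare s p -> exists2 d : R, 0 < d &
     forall x, cabs (x - p) < d -> csquare s x -> P d x) ->
  exists2 d : R, 0 < d & forall x, csquare s x -> P d x.
Proof.
move=> s0 mono loc.
have [|p /csquareP hp|d d0 hd] := @square_compact P (corner s) (2 * s) _ mono.
- by rewrite mulr_gt0.
- by have [d d0 hd] := loc p hp; exists d => // x xp /csquareP; exact: hd.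
by exists d => // x /csquareP; exact: hd.
Qed.

Section Uniform.
Context (F : C -> C -> C) (M : R)
  (hF : forall p1 p2, csquare r p1 -> csquare r p2 -> hol2_at F p1 p2)
  (hM : forall p1 p2, csquare r p1 -> csquare r p2 -> cabs (F p1 p2) <= M).

Lemma hol2_equicontinuous w0 : csquare r w0 -> forall e : R, 0 < e ->
  exists2 d : R, 0 < d & forall x, csquare r x ->
    forall w, cabs (w - w0) < d -> cabs (F x w - F x w0) <= e.
Proof.
move=> hw0 e e0.
apply: (csquare_compact r (fun d x => forall w, cabs (w - w0) < d ->
  cabs (F x w - F x w0) <= e)) => // [d d' x _ dd' h w wd|p hp].
  by apply: h; apply: lt_le_trans wd dd'.
have [d d0 hd] := hol2_continuous _ _ _ (hF _ _ hp hw0) (e / 2) ltac:(by rewrite divr_gt0).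
exists d => // x xp _ w ww0.
apply: le_trans (cabs_tri (F p w0) _ _) _; rewrite (cabs_sub (F p w0)).
have h1 := hd x w xp ww0.
have h2 : cabs (F x w0 - F p w0) <= e / 2 by apply: hd; rewrite ?subrr ?cabs0.
lra.
Qed.

(** Near [(z0, w0)] the integrand moves little, uniformly on the boundary, so the sum moves little
    for every [n] at once. Expressing that [n] is large by [d^-1 <= n] puts all conditions into the
    one parameter [d], in the shape [csquare_compact] needs. *)
Lemma cauchy_sum_local z0 w0 : csquare (r / 2) z0 -> csquare (r / 2) w0 ->
  forall e : R, 0 < e -> exists2 d : R, 0 < d &
    forall n z w, d^-1 <= n%:R -> cabs (z - z0) < d -> cabs (w - w0) < d ->
      csquare (r / 2) z ->
      cabs (B n (fun x => (F x w - F z w) / (x - z))) <= e.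
Proof.
have rp : 0 < r := r0.
move=> hz0 hw0 e e0.
have hz0r := csquare_half _ r0 _ hz0; have hw0r := csquare_half _ r0 _ hw0.
have M0 : 0 <= M by apply: le_trans (hM _ _ hz0r hw0r); exact: cabs_ge0.
have [N hN] : exists N, forall n, (N <= n)%N ->
    cabs (B n (fun x => (F x w0 - F z0 w0) / (x - z0))) <= e / 2.
  apply: (cauchy_sum _ r0 (F ^~ w0) [::]) => //; last by rewrite divr_gt0.
  by move=> p hp _; apply: hol2_cdiff1; exact: hF.
(* The perimeter is [8 r]: integrands that differ by at most [b] have sums that differ by at most
   [e / 2]. *)
pose b := e / (16 * r).
have b0 : 0 < b by rewrite divr_gt0 // mulr_gt0.
have br0 : 0 < b * r / 8 by rewrite divr_gt0 // mulr_gt0.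
have [d1 d10 h1] := hol2_equicontinuous w0 hw0r _ br0.
have [d2 d20 h2] := hol2_continuous _ _ _ (hF _ _ hz0r hw0r) _ br0.
pose d3 := b * r ^+ 2 / (16 * (M + 1)).
have M1 : 0 < M + 1 by lra.
have d30 : 0 < d3 by apply: divr_gt0; rewrite mulr_gt0 ?exprn_gt0.
(* Turns [d^-1 <= n] into [N <= n]. *)
pose d4 : R := N.+1%:R^-1.
have d40 : 0 < d4 by rewrite invr_gt0 ltr0n.
exists (Num.min (Num.min d1 d2) (Num.min d3 d4)); first by rewrite !lt_min d10 d20 d30.
move=> n z w hn; rewrite !lt_min => /andP[/andP[_ z2] /andP[z3 _]].
move=> /andP[/andP[w1 w2] _] hz.
have {hn} nN : (N <= n)%N.
  have : (N.+1%:R : R) <= n%:R.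
    apply: le_trans hn; rewrite -[X in X <= _]invrK lef_pV2 ?posrE //.
      by rewrite !ge_min lexx !orbT.
    by rewrite !lt_min d10 d20 d30.
  by rewrite ler_nat => /ltnW.
have := hN n nN.
pose g x := (F x w - F z w) / (x - z).
pose g0 x := (F x w0 - F z0 w0) / (x - z0).
rewrite -/g -/g0 => hg0.
have : cabs (B n (fun x => g x - g0 x)) <= 4 * (2 * r) * b.
  apply: square_sum_bound; first by rewrite mulr_gt0.
  move=> x hx.
  have xr := bdry_csquare _ r0 _ hx.
  have x1 := bdry_dist _ r0 _ _ hz hx; have x2 := bdry_dist _ r0 _ _ hz0 hx.
  have nz1 : x - z != 0 by rewrite subr_eq0 (bdry_neq _ r0 _ _ hz hx).
  have nz2 : x - z0 != 0 by rewrite subr_eq0 (bdry_neq _ r0 _ _ hz0 hx).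
  have -> : g x - g0 x = (((F x w - F x w0) - (F z w - F z0 w0)) +
      (F x w0 - F z0 w0) * (z - z0) / (x - z0)) / (x - z).
    by rewrite /g /g0; field; rewrite nz1.
  rewrite cabsM cabsV ler_pdivrMr ?cabs_gt0 //.
  apply: le_trans (_ : b * (r / 2) <= _); last by rewrite ler_pM2l.
  have k1 := h1 x xr w w1; have k2 := h2 z w z2 w2.
  have k3 := cabsB (F x w - F x w0) (F z w - F z0 w0).
  have k4 : cabs ((F x w0 - F z0 w0) * (z - z0) / (x - z0)) <= b * r / 4.
    rewrite !cabsM cabsV ler_pdivrMr ?cabs_gt0 //.
    apply: le_trans (_ : b * r / 4 * (r / 2) <= _); last first.
      by rewrite ler_pM2l // divr_gt0 // mulr_gt0.
    apply: le_trans (_ : (2 * (M + 1)) * d3 <= _); last first.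
      rewrite /d3 le_eqVlt; apply/orP; left; apply/eqP; field.
      by rewrite gt_eqF.
    apply: ler_pM; rewrite ?cabs_ge0 //; last exact: ltW.
    apply: le_trans (cabsB _ _) _.
    by have := hM _ _ xr hw0r; have := hM _ _ hz0r hw0r; lra.
  by apply: le_trans (cabsD _ _) _; lra.
rewrite square_sumB => h.
have -> : B n g = (B n g - B n g0) + B n g0 by ring.
apply: le_trans (cabsD _ _) _.
have e2 : 4 * (2 * r) * b = e / 2 by rewrite /b; field; rewrite gt_eqF.
lra.
Qed.

(** Compactness in [w] around the same argument in [z], which makes one [n] serve all pairs. *)
Lemma cauchy_sum_uniform e : 0 < e -> exists n, forall z w,
  csquare (r / 2) z -> csquare (r / 2) w ->
  cabs (B n (fun x => (F x w - F z w) / (x - z))) <= e.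
Proof.
move=> e0.
have r20 : 0 < r / 2 by rewrite divr_gt0.
have inv_mono (d d' : R) (n : nat) : 0 < d' -> d' <= d -> d'^-1 <= n%:R -> d^-1 <= n%:R.
  move=> d'0 dd'; apply: le_trans; rewrite lef_pV2 ?posrE //.
  exact: lt_le_trans dd'.
suff [d d0 hd] : exists2 d : R, 0 < d & forall w, csquare (r / 2) w ->
    forall n z, d^-1 <= n%:R -> csquare (r / 2) z ->
      cabs (B n (fun x => (F x w - F z w) / (x - z))) <= e.
  exists (Num.truncn d^-1).+1 => z w hz hw; apply: hd => //.
  by apply: ltW; exact: truncnS_gt.
apply: (csquare_compact _ (fun d w => forall n z, d^-1 <= n%:R -> csquare (r / 2) z ->
   cabs (B n (fun x => (F x w - F z w) / (x - z))) <= e)) => // [d d' w d'0 dd' h n z hn|w0 hw0].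
  by apply: h; apply: inv_mono hn.
suff [d d0 hd] : exists2 d : R, 0 < d & forall z, csquare (r / 2) z ->
    forall n w, d^-1 <= n%:R -> cabs (w - w0) < d ->
      cabs (B n (fun x => (F x w - F z w) / (x - z))) <= e.
  by exists d => // w ww0 _ n z hn hz; apply: hd.
apply: (csquare_compact _ (fun d z => forall n w, d^-1 <= n%:R -> cabs (w - w0) < d ->
   cabs (B n (fun x => (F x w - F z w) / (x - z))) <= e)) => // [d d' z d'0 dd' h n w hn wd|z0 hz0].
  by apply: h; [apply: inv_mono hn|apply: lt_le_trans dd'].
have [d d0 hd] := cauchy_sum_local z0 w0 hz0 hw0 e e0.
by exists d => // z zd hz n w hn wd; apply: hd.
Qed.

End Uniform.

Section InAlgebra.
Context {T : Type} (D : T -> Prop) (A : (T -> C) -> Prop) (hA : closed_algebra D A).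

Lemma ca_square_sum n (f : C -> T -> C) : (forall x, bdry x -> A (f x)) ->
  A (fun t => B n (f ^~ t)).
Proof.
move=> Af; have cA := ca_const _ _ hA.
have cE a u : (forall t : R, 0 <= t <= 1 -> bdry (a + t%:C * u)) ->
    A (fun t => edge_sum n (f ^~ t) a u).
  move=> hb; apply: (ca_sum _ _ hA) => k; have [t t01 ->] := edge_point n u k.
  by apply: (ca_mul _ _ hA) => //; apply: Af; exact: hb.
apply: (ca_sub _ _ hA); [apply: (ca_add _ _ hA); [apply: (ca_sub _ _ hA)|]|];
  apply: cE => t t01; exists t => //.
- by constructor 1.
- by constructor 2.
- by constructor 3.
- by constructor 4.
Qed.

(** [Phi] is approximated by the sum of [phi x / (x - Z)] divided by the winding sum at [Z]. The
    factor [1/(x - Z)] is a geometric series, as [|Z| <= r/4] and [|x| >= r/2]; the winding sum is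
    inverted by [ca_inv]. Abstract [phi] and [Phi] allow one use per variable. *)
Lemma cauchy_in_algebra (Z : T -> C) (phi : C -> T -> C) (Phi : T -> C) :
  A Z -> (forall t, D t -> cabs (Z t) <= r / 4) ->
  (forall x, bdry x -> A (phi x)) ->
  (forall e : R, 0 < e -> exists n, forall t, D t ->
     cabs (B n (fun x => (phi x t - Phi t) / (x - Z t))) <= e) ->
  A Phi.
Proof.
have rp : 0 < r := r0.
move=> AZ hZ Aphi happ.
have cA := ca_const _ _ hA.
have Zc t : D t -> csquare (r / 2) (Z t).
  by move=> /hZ h; apply: csquare_cabs; lra.
have c0 : csquare (r / 2) (0 : C) by apply: csquare_cabs; rewrite cabs0; lra.
have AI x : bdry x -> A (fun t => (x - Z t)^-1).
  move=> hx; have x2 := bdry_dist _ r0 _ _ c0 hx; rewrite subr0 in x2.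
  have xnz : x != 0 by rewrite -cabs_gt0; lra.
  have h : A (fun t => (1 - x^-1 * Z t)^-1).
    apply: (ca_geom _ _ hA _ 2^-1); first exact: (ca_scale _ _ hA).
      by lra.
    move=> t Dt; rewrite cabsM cabsV mulrC ler_pdivrMr ?cabs_gt0 //.
    by have := hZ t Dt; lra.
  apply: (ca_ext _ _ hA _ _ (ca_scale _ _ hA x^-1 _ h)) => t Dt.
  by rewrite -invfM mulrBr mulr1 mulVKf.
apply: (ca_lim _ _ hA) => e e0.
(* Dividing by a winding sum of modulus at least 1/3 costs a factor 3. *)
have [n hn] := happ (e / 3) ltac:(by rewrite divr_gt0).
exists (fun t => B n (fun x => phi x t / (x - Z t)) * (winding r n (Z t))^-1).
  apply: (ca_mul _ _ hA).
    by apply: (ca_square_sum n (fun x t => phi x t / (x - Z t))) => x hx; apply: (ca_mul _ _ hA); auto.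
  apply: (ca_inv _ _ hA _ (1 / 3) 16).
  - exact: (ca_square_sum n (fun x t => (x - Z t)^-1)).
  - by lra.
  - by move=> t Dt; apply: winding_Im => //; exact: Zc.
  - by move=> t Dt; apply: winding_le => //; exact: Zc.
move=> t Dt; have := hn t Dt.
rewrite (square_sum_eq _ _ (fun x => phi x t / (x - Z t) + (- Phi t) * (x - Z t)^-1)); last first.
  by move=> p _; ring.
rewrite square_sum_lin -/(winding r n (Z t)).
set S := square_sum _ _ _ _; set c := winding _ _ _ => h.
have c3 : 1 / 3 <= cabs c.
  apply: le_trans (winding_Im _ r0 n _ (Zc _ Dt)) _.
  exact: le_trans (ler_norm _) (Im_le_cabs _).
have cnz : c != 0 by rewrite -cabs_gt0; lra.
have -> : Phi t - S * c^-1 = - (S + - Phi t * c) / c by field.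
rewrite cabsM cabsN cabsV ler_pdivrMr ?cabs_gt0 //; nra.
Qed.

(** A functional calculus by iterated Cauchy sums: the outer one, in the first variable, needs
    [F x (W t)] in [A] for fixed [x], and the inner one supplies it from constants. *)
Lemma hol2_in_algebra (F : C -> C -> C) (M : R) (Z W : T -> C) :
  (forall p1 p2, csquare r p1 -> csquare r p2 -> hol2_at F p1 p2) ->
  (forall p1 p2, csquare r p1 -> csquare r p2 -> cabs (F p1 p2) <= M) ->
  A Z -> A W -> (forall t, D t -> cabs (Z t) <= r / 4) ->
  (forall t, D t -> cabs (W t) <= r / 4) ->
  A (fun t => F (Z t) (W t)).
Proof.
have rp : 0 < r := r0.
move=> hF hM AZ AW hZ hW.
have c4 (z : C) : cabs z <= r / 4 -> csquare (r / 2) z.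
  by move=> h; apply: csquare_cabs; lra.
apply: (cauchy_in_algebra Z (fun x t => F x (W t))) => // [x hx|e e0].
  have xr := bdry_csquare _ r0 _ hx.
  apply: (cauchy_in_algebra W (fun y _ => F x y)) => // [y hy|e e0].
    exact: (ca_const _ _ hA).
  have [||n hn] := cauchy_sum_uniform (fun y _ => F x y) M _ _ e e0.
  - by move=> p1 p2 h1 _; apply: hol2_fst; apply: (hol2_cdiff1 _ _ _ (hol2_swap _ _ _ (hF _ _ xr h1))).
  - by move=> p1 p2 h1 _; apply: hM.
  by exists n => t Dt; apply: (hn _ (W t)); apply: c4; exact: hW.
have [n hn] := cauchy_sum_uniform F M hF hM e e0.
by exists n => t Dt; apply: hn; apply: c4; [exact: hZ|exact: hW].
Qed.

End InAlgebra.
End TwoVariables.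

(** * Approximation of g by the conjugate *)

Section ConjugateApproximation.
Context {R : realType}.
Local Notation C := R[i].
Local Notation cabs := (@ComplexField.Normc.normc R).

Definition has_rderiv (phi : R -> C) (t : R) (c : C) : Prop :=
  forall e : R, 0 < e -> exists2 d : R, 0 < d & forall h : R, h != 0 ->
    `|h| < d -> cabs ((phi (t + h) - phi t) / h%:C - c) < e.

(** [has_dz], [has_dzbar] and [C1_near0] each bring their own partial derivatives; this identifies
    them at 0. *)
Lemma rderiv_unique phi t c c' : has_rderiv phi t c -> has_rderiv phi t c' -> c = c'.
Proof.
move=> hc hc'; apply/eqP; rewrite -subr_eq0 -cabs_eq0; apply/eqP/le_anti.
rewrite cabs_ge0 andbT; apply/ler_addgt0Pr => e e0; rewrite add0r.
have e20 : 0 < e / 2 by rewrite divr_gt0.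
have [d d0 hd] := hc _ e20; have [d' d'0 hd'] := hc' _ e20.
pose h := Num.min d d' / 2.
have m0 : 0 < Num.min d d' by rewrite lt_min d0.
have h0 : 0 < h by rewrite divr_gt0.
have hh : h < Num.min d d' by rewrite /h; lra.
move: hh; rewrite lt_min => /andP[h1 h2].
have := hd h; rewrite gt_eqF // gtr0_norm // => /(_ isT h1) k1.
have := hd' h; rewrite gt_eqF // gtr0_norm // => /(_ isT h2) k2.
apply: le_trans (cabs_tri ((phi (t + h) - phi t) / h%:C) _ _) _.
by rewrite cabs_sub; lra.
Qed.

(** The mean value inequality for complex values, where no intermediate point need exist. Increments
    add up under halving, so bisection with a slack [eta] suffices. *)
Lemma rderiv_bound (phi : R -> C) (a s K : R) : 0 < s ->
  (forall t, a <= t <= a + s -> exists2 c, has_rderiv phi t c & cabs c <= K) ->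
  cabs (phi (a + s) - phi a) <= K * s.
Proof.
move=> s0 hphi.
suff main eta : 0 < eta -> cabs (phi (a + s) - phi a) <= (K + eta) * s.
  apply/ler_addgt0Pr => e e0; apply: le_trans (main (e / s) _) _.
    by rewrite divr_gt0.
  by rewrite mulrDl mulfVK // gt_eqF.
move=> eta0.
(* Bisection of squares is reused for an interval: only real parts matter, so two of the four
   quarters suffice. *)
pose P (x : C) (s : R) :=
  cabs (phi (complex.Re x + s) - phi (complex.Re x)) <= (K + eta) * s.
apply: (square_bisection P (a +i* 0) s) => // [x u u0|p [/= hp _]].
  rewrite /P !ReImE !(mulr0, mul0r, mulr1, addr0, add0r, subr0) => h1 h2 _ _.
  rewrite -addrA -splitr in h2.
  apply: le_trans (cabs_tri (phi (complex.Re x + u / 2)) _ _) _.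
  by apply: le_trans (lerD h2 h1) _; rewrite le_eqVlt; apply/orP; left; apply/eqP; field.
set t := complex.Re p in hp *.
have [c hc cK] := hphi t hp.
have [d d0 hd] := hc eta eta0.
have step h : `|h| < d -> cabs (phi (t + h) - phi t) <= (K + eta) * `|h|.
  move=> hh; have [->|h0] := eqVneq h 0.
    by rewrite addr0 subrr cabs0 normr0 mulr0.
  have := hd h h0 hh => hlt.
  have hC : h%:C != 0 :> C by rewrite -cabs_gt0 cabs_real normr_gt0.
  have -> : phi (t + h) - phi t = ((phi (t + h) - phi t) / h%:C - c + c) * h%:C.
    by field.
  rewrite cabsM cabs_real; apply: ler_wpM2r; first exact: normr_ge0.
  by apply: le_trans (cabsD _ _) _; lra.
exists d => // x u u0 ud [+ _]; rewrite -/t => /andP[xt tx].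
have ux : complex.Re x + u - t < d by lra.
have xx : t - complex.Re x < d by lra.
have := step (complex.Re x + u - t); rewrite ger0_norm; last by lra.
move=> /(_ ux); rewrite [t + _]addrC subrK => k1.
have := step (complex.Re x - t); rewrite ler0_norm; last by lra.
rewrite opprB => /(_ xx); rewrite [t + _]addrC subrK cabs_sub => k2.
rewrite /P; apply: le_trans (cabs_tri (phi t) _ _) _.
by apply: le_trans (lerD k1 k2) _; rewrite le_eqVlt; apply/orP; left; apply/eqP; ring.
Qed.

Lemma rderiv_affine_bound (phi : R -> C) (a : C) (y K : R) :
  (forall t, `|t| <= `|y| -> exists2 c, has_rderiv phi t c & cabs (c - a) <= K) ->
  cabs (phi y - phi 0 - a * y%:C) <= K * `|y|.
Proof.
move=> hphi.
pose psi t := phi t - a * t%:C.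
have hpsi t : `|t| <= `|y| -> exists2 c, has_rderiv psi t c & cabs c <= K.
  move=> /hphi[c hc cK]; exists (c - a) => // e e0.
  have [d d0 hd] := hc e e0; exists d => // h h0 hh; have := hd h h0 hh.
  have hC : h%:C != 0 :> C by rewrite -cabs_gt0 cabs_real normr_gt0.
  rewrite /psi rmorphD /=; congr (cabs _ < _); field; exact: hC.
have -> : phi y - phi 0 - a * y%:C = psi y - psi 0.
  by rewrite /psi [0%:C]rmorph0; ring.
have [y0|y0|->] := ltgtP y 0; last by rewrite subrr cabs0 normr0 mulr0.
- rewrite ltr0_norm // cabs_sub -[X in psi X - _](subrr y).
  apply: rderiv_bound => [|t]; first by rewrite oppr_gt0.
  by rewrite subrr => ht; apply: hpsi; rewrite (ltr0_norm y0) ler0_norm; lra.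
- rewrite gtr0_norm // -[X in psi X - _]add0r.
  apply: rderiv_bound => // t; rewrite add0r => ht.
  by apply: hpsi; rewrite (gtr0_norm y0) ger0_norm; lra.
Qed.

Lemma has_dx_rderiv g p a : has_dx g p a -> has_rderiv (fun t => g (p + t%:C)) 0 a.
Proof.
move=> h e /h [d d0 hd]; exists d => // t t0 td.
by rewrite add0r [0%:C]rmorph0 addr0; apply: hd.
Qed.

Lemma has_dy_rderiv g p a : has_dy g p a ->
  has_rderiv (fun t => g (p + t%:C * 'i)) 0 a.
Proof.
move=> h e /h [d d0 hd]; exists d => // t t0 td.
by rewrite add0r [0%:C]rmorph0 mul0r addr0; apply: hd.
Qed.

(** The path from 0 along the real axis to [x] and then vertically to [z] reduces the claim to [gx]
    near 1 and [gy] near [-i], the partial derivatives of the conjugate. *)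
Lemma C1_conj_approx (g : C -> C) : C1_near0 g -> g 0 = 0 ->
  has_dz g 0 0 -> has_dzbar g 0 1 ->
  forall e : R, 0 < e -> exists2 d : R, 0 < d & forall z, cabs z < d ->
    cabs (g z - conjc z) <= e * cabs z.
Proof.
move=> [r r0 [gx [gy [hg cx cy]]]] g0 [ax [ay [hax hay hz]]] [bx [by' [hbx hby hzb]]] e e0.
have o0 : odisk r 0 by rewrite /odisk cabs0.
have [hx0 hy0] := hg 0 o0.
have uniqx a : has_dx g 0 a -> a = gx 0.
  by move=> h; apply: rderiv_unique (has_dx_rderiv _ _ _ h) (has_dx_rderiv _ _ _ hx0).
have uniqy a : has_dy g 0 a -> a = gy 0.
  by move=> h; apply: rderiv_unique (has_dy_rderiv _ _ _ h) (has_dy_rderiv _ _ _ hy0).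
rewrite (uniqx _ hax) (uniqy _ hay) in hz.
rewrite (uniqx _ hbx) (uniqy _ hby) in hzb.
have i2 := sqr_i R.
have gx0 : gx 0 = 1.
  transitivity ((gx 0 - 'i * gy 0) / 2%:R + (gx 0 + 'i * gy 0) / 2%:R); first by field.
  by rewrite -hz -hzb add0r.
have gy0 : gy 0 = - 'i.
  transitivity (- 'i * ((gx 0 + 'i * gy 0) / 2%:R - (gx 0 - 'i * gy 0) / 2%:R)).
    by rewrite [RHS](_ : _ = - ('i ^+ 2) * gy 0); [rewrite i2; ring|field].
  by rewrite -hz -hzb subr0 mulr1.
have [d1 d10 h1] := cx 0 o0 (e / 2) ltac:(by rewrite divr_gt0).
have [d2 d20 h2] := cy 0 o0 (e / 2) ltac:(by rewrite divr_gt0).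
rewrite gx0 in h1; rewrite gy0 in h2.
pose d := Num.min r (Num.min d1 d2).
(* Points of the path have modulus at most [|x| + |y| <= 2 |z|]. *)
exists (d / 2) => [|z hz2]; first by rewrite divr_gt0 // !lt_min r0 d10.
have dr p : cabs p < d -> [/\ odisk r p, cabs (p - 0) < d1 & cabs (p - 0) < d2].
  by rewrite /d !lt_min subr0 => /and3P.
have hRe := Re_le_cabs z; have hIm := Im_le_cabs z.
set x := complex.Re z in hRe *; set y := complex.Im z in hIm *.
have zE : z = x%:C + y%:C * 'i by exact: complex_eta.
have zJ : conjc z = x%:C - y%:C * 'i by exact: conjc_eta.
have b1 : cabs (g x%:C - g 0%:C - 1 * x%:C) <= e / 2 * `|x|.
  apply: (rderiv_affine_bound (fun t => g t%:C)) => t ht.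
  have [|o1 o2 _] := dr t%:C; first by rewrite cabs_real; have := cabs_ge0 z; lra.
  have [hx _] := hg _ o1; exists (gx t%:C); last by apply: ltW; exact: h1.
  move=> e' /hx [d' d'0 hd']; exists d' => // h hh0 hhd.
  by rewrite rmorphD; apply: hd'.
have b2 : cabs (g (x%:C + y%:C * 'i) - g (x%:C + 0%:C * 'i) - (- 'i) * y%:C) <= e / 2 * `|y|.
  apply: (rderiv_affine_bound (fun t => g (x%:C + t%:C * 'i))) => t ht.
  have [|o1 _ o2] := dr (x%:C + t%:C * 'i).
    apply: le_lt_trans (cabsD _ _) _; rewrite cabsM cabs_i mulr1 !cabs_real.
    by have := cabs_ge0 z; lra.
  have [_ hy] := hg _ o1; exists (gy (x%:C + t%:C * 'i)); last by apply: ltW; exact: h2.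
  move=> e' /hy [d' d'0 hd']; exists d' => // h hh0 hhd.
  have -> : x%:C + (t + h)%:C * 'i = x%:C + t%:C * 'i + h%:C * 'i.
    by rewrite rmorphD; ring.
  exact: hd'.
move: b1 b2; rewrite [0%:C]rmorph0 g0 mul0r addr0 -zE => b1 b2.
have -> : g z - conjc z = (g z - g x%:C - - 'i * y%:C) + (g x%:C - 0 - 1 * x%:C).
  by rewrite zJ; ring.
apply: le_trans (cabsD _ _) _; apply: le_trans (lerD b2 b1) _.
have : e / 2 * `|x| <= e / 2 * cabs z by rewrite ler_pM2l // divr_gt0.
have : e / 2 * `|y| <= e / 2 * cabs z by rewrite ler_pM2l // divr_gt0.
lra.
Qed.

End ConjugateApproximation.

(** * Closures of polynomials *)

Section PolynomialClosure.
Context {R : realType}.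
Local Notation C := R[i].
Local Notation cabs := (@ComplexField.Normc.normc R).

(** Passing to [{poly {poly C}}] provides sums and products of polynomials without convolving
    coefficient arrays. *)
Lemma poly2_eval_horner n c : exists P : {poly {poly C}},
  forall a b, poly2_eval n c a b = P.[b%:P].[a].
Proof.
exists (\sum_(i < n) \sum_(j < n) (c i j *: 'X^i)%:P * 'X^j) => a b.
rewrite /poly2_eval !horner_sum; apply: eq_bigr => i _.
rewrite !horner_sum; apply: eq_bigr => j _.
by rewrite !hornerE.
Qed.

Lemma horner_poly2_eval (P : {poly {poly C}}) : exists n c,
  forall a b, P.[b%:P].[a] = poly2_eval n c a b.
Proof.
(* [poly2_eval] truncates both exponents at the same [n]. *)
pose n := maxn (size P) (\max_(j < size P) size (P`_j)%R).
exists n, (fun i j => P`_j`_i) => a b.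
have szj j : (size (P`_j)%R <= n)%N.
  have [hj|hj] := ltnP j (size P); last by rewrite nth_default // size_poly0.
  by rewrite leq_max; apply/orP; right;
  exact: (leq_bigmax_cond (F := fun j : 'I_(size P) => size (P`_j)%R) (Ordinal hj) isT).
rewrite /poly2_eval exchange_big /= (horner_coef_wide _ (leq_maxl _ _ : size P <= n)%N).
rewrite horner_sum; apply: eq_bigr => j _.
rewrite hornerM (horner_coef_wide _ (szj j)) big_distrl /=; apply: eq_bigr => i _.
by rewrite -polyC_exp hornerC.
Qed.

Lemma poly2_eval_bounded n (c : nat -> nat -> C) (K : R) : exists L, forall a b,
  cabs a <= K -> cabs b <= K -> cabs (poly2_eval n c a b) <= L.
Proof.
exists (\sum_(i < n) \sum_(j < n) cabs (c i j) * K ^+ i * K ^+ j) => a b ha hb.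
apply: le_trans (cabs_sum _ _ _) _; apply: ler_sum => i _.
apply: le_trans (cabs_sum _ _ _) _; apply: ler_sum => j _.
rewrite !cabsM !cabsX.
have K0 : 0 <= K by apply: le_trans ha; exact: cabs_ge0.
apply: ler_pM; rewrite ?mulr_ge0 ?exprn_ge0 ?cabs_ge0 //; last first.
  by apply: lerXn2r; rewrite ?nnegrE ?cabs_ge0.
by apply: ler_wpM2l; rewrite ?cabs_ge0 //; apply: lerXn2r; rewrite ?nnegrE ?cabs_ge0.
Qed.

(** [in_poly_closure] over an arbitrary index type, so that it also applies to the doubled set; at
    [T = C] the two are convertible. *)
Definition poly_closure {T : Type} (D : T -> Prop) (f1 f2 h : T -> C) : Prop :=
  forall e : R, 0 < e -> exists n c,
    forall t, D t -> cabs (h t - poly2_eval n c (f1 t) (f2 t)) <= e.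

Section Generic.
Context {T : Type} (D : T -> Prop) (f1 f2 : T -> C).

Lemma poly_closure_horner (P : {poly {poly C}}) :
  poly_closure D f1 f2 (fun t => P.[(f2 t)%:P].[f1 t]).
Proof.
move=> e e0; have [n [c h]] := horner_poly2_eval P; exists n, c => t _.
by rewrite h subrr cabs0 ltW.
Qed.

Lemma poly_closure_approx h : poly_closure D f1 f2 h -> forall e : R, 0 < e ->
  exists P : {poly {poly C}}, forall t, D t -> cabs (h t - P.[(f2 t)%:P].[f1 t]) <= e.
Proof.
move=> hh e /hh [n [c hn]]; have [P hP] := poly2_eval_horner n c.
by exists P => t /hn; rewrite hP.
Qed.

Lemma poly_closure_lim h : (forall e : R, 0 < e ->
    exists2 k, poly_closure D f1 f2 k & forall t, D t -> cabs (h t - k t) <= e) ->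
  poly_closure D f1 f2 h.
Proof.
move=> hh e e0; have e20 : 0 < e / 2 by rewrite divr_gt0.
have [k hk hk1] := hh _ e20; have [n [c hn]] := hk _ e20; exists n, c => t Dt.
by apply: le_trans (cabs_tri (k t) _ _) _; have := hk1 t Dt; have := hn t Dt; lra.
Qed.

Lemma poly_closure1 : poly_closure D f1 f2 f1.
Proof.
by have := poly_closure_horner ('X%:P); congr poly_closure; apply/funext => t; rewrite !hornerE.
Qed.

Lemma poly_closure2 : poly_closure D f1 f2 f2.
Proof.
by have := poly_closure_horner 'X; congr poly_closure; apply/funext => t; rewrite !hornerE.
Qed.

Lemma poly_closure_min A h : closed_algebra D A -> A f1 -> A f2 ->
  poly_closure D f1 f2 h -> A h.
Proof.
move=> hA A1 A2 hh; apply: (ca_lim _ _ hA) => e /hh [n [c hn]].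
exists (fun t => poly2_eval n c (f1 t) (f2 t)) => //.
apply: (ca_sum _ _ hA) => i; apply: (ca_sum _ _ hA) => j.
apply: (ca_mul _ _ hA); last exact: (ca_exp _ _ hA).
by apply: (ca_scale _ _ hA); exact: (ca_exp _ _ hA).
Qed.

(** Bounded generators make all elements of the closure bounded, as stability under products
    requires. *)
Lemma poly_closure_algebra (K : R) : (forall t, D t -> cabs (f1 t) <= K) ->
  (forall t, D t -> cabs (f2 t) <= K) -> closed_algebra D (poly_closure D f1 f2).
Proof.
move=> b1 b2.
have bounded h : poly_closure D f1 f2 h -> exists2 L : R, 0 < L & forall t, D t -> cabs (h t) <= L.
  move=> /(_ 1 ltr01) [n [c hn]]; have [L hL] := poly2_eval_bounded n c K.
  exists (`|L| + 1) => [|t Dt]; first by have := normr_ge0 L; lra.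
  have := cabsD (h t - poly2_eval n c (f1 t) (f2 t)) (poly2_eval n c (f1 t) (f2 t)).
  rewrite subrK => h1; have := hn t Dt; have := hL _ _ (b1 t Dt) (b2 t Dt).
  have := ler_norm L; lra.
split.
- move=> c; have := poly_closure_horner (c%:P)%:P; congr poly_closure; apply/funext => t.
  by rewrite !hornerE.
- move=> h k hh hk; apply: poly_closure_lim => e e0.
  have e20 : 0 < e / 2 by rewrite divr_gt0.
  have [P hP] := poly_closure_approx _ hh _ e20.
  have [Q hQ] := poly_closure_approx _ hk _ e20.
  exists (fun t => (P + Q).[(f2 t)%:P].[f1 t]); first exact: poly_closure_horner.
  move=> t Dt; rewrite !hornerE opprD addrACA.
  by apply: le_trans (cabsD _ _) _; have := hP t Dt; have := hQ t Dt; lra.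
- move=> h k hh hk; apply: poly_closure_lim => e e0.
  have [L1 L10 hL1] := bounded _ hh; have [L2 L20 hL2] := bounded _ hk.
  (* The bound 1 keeps the approximant [p] below [L1 + 1]; the other bounds make each term of
     [(h - p) k + p (k - q)] at most [e / 2]. *)
  pose e1 := Num.min 1 (e / (2 * L2)); pose e2 := e / (2 * (L1 + 1)).
  have e20 : 0 < e2 by rewrite divr_gt0 // mulr_gt0 // addr_gt0.
  have e10 : 0 < e1 by rewrite lt_min ltr01 divr_gt0 // mulr_gt0.
  have [P hP] := poly_closure_approx _ hh _ e10.
  have [Q hQ] := poly_closure_approx _ hk _ e20.
  exists (fun t => (P * Q).[(f2 t)%:P].[f1 t]); first exact: poly_closure_horner.
  move=> t Dt; rewrite !hornerM.
  have := hP t Dt; rewrite le_min => /andP[]; have := hQ t Dt.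
  set p := P.[_].[_]; set q := Q.[_].[_] => hq hp1 hp2.
  have -> : h t * k t - p * q = (h t - p) * k t + p * (k t - q) by ring.
  have hp : cabs p <= L1 + 1.
    have := cabsB (h t) (h t - p); rewrite (_ : h t - (h t - p) = p); last by ring.
    by have := hL1 t Dt; lra.
  apply: le_trans (cabsD _ _) _; rewrite !cabsM.
  have k1 : cabs (h t - p) * cabs (k t) <= e / (2 * L2) * L2.
    by apply: ler_pM; rewrite ?cabs_ge0 // hL2.
  have k2 : cabs p * cabs (k t - q) <= (L1 + 1) * e2.
    by apply: ler_pM; rewrite ?cabs_ge0.
  have E1 : e / (2 * L2) * L2 = e / 2 by field; rewrite gt_eqF.
  have E2 : (L1 + 1) * e2 = e / 2 by rewrite /e2; field; rewrite gt_eqF // addr_gt0.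
  lra.
- exact: poly_closure_lim.
Qed.

End Generic.
End PolynomialClosure.

(** * Doubling *)

Section Disk.
Context {R : realType}.
Local Notation C := R[i].
Local Notation cabs := (@ComplexField.Normc.normc R).

(* Over the index type [C * bool], the pair (dblZ, dblW f) parametrizes the union
   of the graph of [f] and of its image under [(z, w) |-> (-z, -w)]. *)
Definition dblZ (t : C * bool) : C := (-1) ^+ t.2 * t.1.
Definition dblW (f : C -> C) (t : C * bool) : C := (-1) ^+ t.2 * f t.1.
Definition dbl (D : C -> Prop) (t : C * bool) : Prop := D t.1.

Lemma cabs_sign (b : bool) (z : C) : cabs ((-1) ^+ b * z) = cabs z.
Proof. by case: b; rewrite ?expr1 ?expr0 ?mulN1r ?mul1r ?cabsN. Qed.

(** As [i] and [j] have the same parity, the monomial is a product of powers of [z^2] and [f^2],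
    times one factor [z f] if both are odd. *)
Lemma even_monomial (T : Type) (D : T -> Prop) A (z f : T -> C) (i j : nat) :
  closed_algebra D A -> A (fun t => z t ^+ 2) -> A (fun t => f t ^+ 2) ->
  A (fun t => z t * f t) -> ~~ odd (i + j) -> A (fun t => z t ^+ i * f t ^+ j).
Proof.
move=> hA A1 A2 A3; rewrite oddD negb_add => /eqP hij.
have := ca_mul _ _ hA _ _ (ca_exp _ _ hA _ (odd i) A3)
  (ca_mul _ _ hA _ _ (ca_exp _ _ hA _ i./2 A1) (ca_exp _ _ hA _ j./2 A2)).
move=> /(ca_ext _ _ hA); apply=> t _.
rewrite -{1}(odd_double_half i) -{1}(odd_double_half j) !exprD -hij exprMn.
rewrite -!mul2n !exprM; ring.
Qed.

(** [h t.1] agrees on the two sheets, so averaging an approximating polynomial over them keeps the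
    error and cancels the odd monomials. *)
Lemma even_part_closure (D : C -> Prop) A (f h : C -> C) : closed_algebra D A ->
  A (fun z => z ^+ 2) -> A (fun z => f z ^+ 2) -> A (fun z => z * f z) ->
  poly_closure (dbl D) dblZ (dblW f) (fun t => h t.1) -> A h.
Proof.
move=> hA A1 A2 A3 hh; apply: (ca_lim _ _ hA) => e /hh [n [c hn]].
exists (fun z => \sum_(i < n) \sum_(j < n)
    c i j * ((1 + (-1) ^+ (i + j)) / 2%:R) * (z ^+ i * f z ^+ j)).
  apply: (ca_sum _ _ hA) => i; apply: (ca_sum _ _ hA) => j.
  have [o|ev] := boolP (odd (i + j)); last first.
    exact: (ca_scale _ _ hA _ _ (even_monomial _ _ _ _ _ _ _ hA A1 A2 A3 ev)).
  apply: (ca_ext _ _ hA _ _ (ca_const _ _ hA 0)) => z _.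
  by rewrite -signr_odd o expr1 subrr mul0r mulr0 mul0r.
move=> z Dz.
have hp := hn (z, false) Dz; have hm := hn (z, true) Dz.
have -> : h z - \sum_(i < n) \sum_(j < n)
    c i j * ((1 + (-1) ^+ (i + j)) / 2%:R) * (z ^+ i * f z ^+ j) =
  ((h z - poly2_eval n c z (f z)) + (h z - poly2_eval n c (- z) (- f z))) / 2%:R.
  have -> : h z = (h z + h z) / 2%:R by field.
  rewrite {3 4}[h z](_ : _ = (h z + h z) / 2%:R); last by field.
  suff -> : \sum_(i < n) \sum_(j < n)
    c i j * ((1 + (-1) ^+ (i + j)) / 2%:R) * (z ^+ i * f z ^+ j) =
    (poly2_eval n c z (f z) + poly2_eval n c (- z) (- f z)) / 2%:R by field.
  rewrite /poly2_eval -big_split big_distrl /=; apply: eq_bigr => i _.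
  rewrite -big_split big_distrl /=; apply: eq_bigr => j _.
  rewrite (exprNn z) (exprNn (f z)) exprD; ring.
rewrite cabsM cabsV cabs_nat ler_pdivrMr //.
move: hp hm; rewrite /dblZ /dblW /= !expr0 !expr1 !mul1r !mulN1r => hp hm.
by apply: le_trans (cabsD _ _) _; lra.
Qed.

Section CloseToConj.
Context (r : R) (hr : r <= 1 / 2) (f : C -> C)
  (hf : forall z, cdisk r z -> cabs (f z - conjc z) <= cabs z / 4).

Lemma close_le z : cdisk r z -> cabs (f z) <= 5 / 4 * cabs z.
Proof.
move=> Dz; have := cabsD (f z - conjc z) (conjc z); rewrite subrK.
have -> : cabs (conjc z) = cabs z by case: z {Dz} => a b /=; rewrite sqrrN.
by have := hf z Dz; lra.
Qed.

Lemma sqr_closure_algebra : closed_algebra (cdisk r)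
  (poly_closure (cdisk r) (fun z => z ^+ 2) (fun z => f z ^+ 2)).
Proof.
have hr' := hr.
apply: (poly_closure_algebra _ _ _ 1) => z Dz; rewrite cabsX.
  by rewrite expr_le1 ?cabs_ge0 //; apply: le_trans Dz _; lra.
rewrite expr_le1 ?cabs_ge0 //; apply: le_trans (close_le z Dz) _.
by move: Dz; rewrite /cdisk; lra.
Qed.

(** Writing [z f = |z|^2 + y] with [|y| <= |z|^2 / 4] gives both inequalities of [ca_sqrt]. At
    [z = 0] they are equalities, so the error has to be relative to [|z|^2]. *)
Lemma mulz_in_sqr_closure :
  poly_closure (cdisk r) (fun z => z ^+ 2) (fun z => f z ^+ 2) (fun z => z * f z).
Proof.
have hr' := hr.
have hA := sqr_closure_algebra.
apply: (ca_sqrt _ _ hA).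
  apply: (ca_ext _ _ hA _ _ (ca_mul _ _ hA _ _ (poly_closure1 _ _ _) (poly_closure2 _ _ _))) => z _.
  by rewrite exprMn.
move=> z Dz.
pose x := cabs z ^+ 2.
have zJ : z * conjc z = x%:C.
  rewrite /x cabs_sqr; case: z {x Dz} => a b; apply/eqP; rewrite eq_complex /=.
  by apply/andP; split; apply/eqP; ring.
pose y := z * (f z - conjc z).
have -> : z * f z = x%:C + y by rewrite -zJ /y; ring.
have x0 : 0 <= x by rewrite sqr_ge0.
have zr : cabs z <= 1 / 2 by apply: le_trans Dz _.
have x1 : x <= 1 / 4 by rewrite /x; have := cabs_ge0 z; nra.
have hy : cabs y <= x / 4.
  rewrite /y cabsM /x expr2 -mulrA; apply: ler_wpM2l; first exact: cabs_ge0.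
  exact: hf.
move: (y) hy => {}y hy; split.
  have -> : 1 - (x%:C + y) = (1 - x)%:C - y by rewrite rmorphB rmorph1; ring.
  apply: le_trans (cabsB _ _) _; rewrite cabs_real ger0_norm; lra.
have -> : 1 - (x%:C + y) ^+ 2 = (1 - x ^+ 2)%:C - (2 * x%:C * y + y ^+ 2).
  by rewrite rmorphB rmorph1 (rmorphXn _ 2 x); ring.
apply: le_trans (cabsB _ _) _; rewrite cabs_real ger0_norm; last by nra.
have := cabsD (2 * x%:C * y) (y ^+ 2).
rewrite cabsX !cabsM cabs_nat cabs_real (ger0_norm x0).
have := cabs_ge0 y; nra.
Qed.

End CloseToConj.

(* The square of [dblW f2] is even, so membership on the doubled set descends. *)
Lemma sqr_closure_transfer (r : R) (f1 f2 h : C -> C) : r <= 1 / 2 ->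
  (forall z, cdisk r z -> cabs (f1 z - conjc z) <= cabs z / 4) ->
  poly_closure (dbl (cdisk r)) dblZ (dblW f1) (dblW f2) ->
  poly_closure (cdisk r) (fun z => z ^+ 2) (fun z => f2 z ^+ 2) h ->
  poly_closure (cdisk r) (fun z => z ^+ 2) (fun z => f1 z ^+ 2) h.
Proof.
move=> hr hf hW; have hA := sqr_closure_algebra _ hr _ hf.
have A1 := poly_closure1 (cdisk r) (fun z => z ^+ 2) (fun z => f1 z ^+ 2).
have A2 := poly_closure2 (cdisk r) (fun z => z ^+ 2) (fun z => f1 z ^+ 2).
apply: poly_closure_min => //.
apply: (even_part_closure _ _ _ _ hA A1 A2 (mulz_in_sqr_closure _ hr _ hf)).
have hB : closed_algebra (dbl (cdisk r)) (poly_closure (dbl (cdisk r)) dblZ (dblW f1)).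
  apply: (poly_closure_algebra _ _ _ 1) => -[z b] /= Dz; rewrite cabs_sign /=.
    by move: Dz; rewrite /dbl /cdisk /=; lra.
  have := close_le _ _ hf z Dz; move: Dz; rewrite /dbl /cdisk /=; lra.
apply: (ca_ext _ _ hB _ _ (ca_exp _ _ hB _ 2 hW)) => -[z b] _ /=.
by rewrite /dblW exprMn -exprM mulnC exprM sqrrN expr1n expr1n mul1r.
Qed.

End Disk.

(** * Choice of the radii, and the equivalence *)

Lemma small_radius (R : realType) (M b : R) : 0 <= M -> 0 < b ->
  exists r : R, [/\ 0 < r, r < b, 192 * (M * (2 * r) ^+ 3) / r <= 1 / 2,
    M * (2 * r) ^+ 3 <= r / 8 & 64 * M * r ^+ 2 <= 1].
Proof.
(* After division by [r], every condition bounds a multiple of [M r^2], the largest being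
   [1536 M r^2 <= 1/2]. They make [F] a contraction in [w], keep the iterates in the domain, and
   bound [F(z, g)] by [|z| / 8]. *)
move=> M0 b0; pose q := 4000 * (M + 1).
have q0 : 0 < q by rewrite mulr_gt0 // ltr_wpDl.
pose r := Num.min 1 (Num.min (b / 2) q^-1).
have r0 : 0 < r by rewrite !lt_min ltr01 divr_gt0 // invr_gt0.
have [r1 rb rq] : [/\ r <= 1, r <= b / 2 & r * q <= 1].
  split; [by rewrite ge_min lexx|by rewrite !ge_min lexx orbT|].
  by rewrite -ler_pdivlMr // mul1r !ge_min lexx !orbT.
have Mr : M * r ^+ 2 <= 1 / 4000.
  have h := ler_pM (mulr_ge0 (ltW r0) (ltW q0)) (ltW r0) rq r1.
  by rewrite /q in h; have := sqr_ge0 r; rewrite !expr2; lra.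
exists r; split => //; first by lra.
- rewrite (_ : _ / r = 1536 * (M * r ^+ 2)); first by lra.
  by field; rewrite gt_eqF.
- rewrite (_ : M * _ = r * (8 * (M * r ^+ 2))); last by ring.
  by apply: ler_wpM2l; [exact: ltW|lra].
- lra.
Qed.

Local Notation cabs := (@ComplexField.Normc.normc _).

Theorem theorem4p1 (R : realType) (g : R[i] -> R[i]) (F : R[i] -> R[i] -> R[i])
  (hgC1 : C1_near0 g) (hg0 : g 0 = 0)
  (hgz : has_dz g 0 0) (hgzbar : has_dzbar g 0 1)
  (hsep : separate_near0 (fun z => z ^+ 2) (fun z => g z ^+ 2))
  (hFhol : holomorphic2_near0 F) (hFodd : odd2_near0 F)
  (hFO3 : bigO3_near0 F) :
  exists2 r0 : R, 0 < r0 & forall r : R, 0 < r -> r < r0 ->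
    (poly_closure_is_CD (fun z => z ^+ 2) (fun z => g z ^+ 2) (cdisk r) <->
     poly_closure_is_CD (fun z => z ^+ 2)
       (fun z => (g z + F z (g z)) ^+ 2) (cdisk r)).
Proof.
have [rF rF0 hF] := hFhol; have [rO rO0 hO] := hFodd.
have [M0 [rM [rM0 hM0]]] := hFO3.
pose M := `|M0|.
have hM w1 w2 : cnorm2 w1 w2 < rM -> cabs (F w1 w2) <= M * cnorm2 w1 w2 ^+ 3.
  move=> h; apply: le_trans (hM0 _ _ h) _; apply: ler_wpM2r; last exact: ler_norm.
  by rewrite exprn_ge0 // le_max cabs_ge0.
pose b := Num.min (rF / 2) (Num.min (rO / 2) (rM / 2)).
have b0 : 0 < b by rewrite !lt_min !divr_gt0.
have [p [p0 pb hlip hbd h64]] := @small_radius R M b (normr_ge0 _) b0.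
move: pb; rewrite !lt_min => /and3P[pF pO pM].
have cs2 w1 w2 : cabs w1 <= 2 * p -> cabs w2 <= 2 * p ->
    [/\ cnorm2 w1 w2 < rF, cnorm2 w1 w2 < rO, cnorm2 w1 w2 < rM & cnorm2 w1 w2 <= 2 * p].
  by move=> h1 h2; rewrite /cnorm2 !gt_max ge_max; split; apply/andP; split; lra.
have Fhol p1 p2 : csquare p p1 -> csquare p p2 -> hol2_at F p1 p2.
  by move=> /cabs_csquare h1 /cabs_csquare h2; apply: hF; have [] := cs2 _ _ h1 h2.
have Fb p1 p2 : csquare p p1 -> csquare p p2 -> cabs (F p1 p2) <= M * (2 * p) ^+ 3.
  move=> /cabs_csquare h1 /cabs_csquare h2; have [_ _ h3 h4] := cs2 _ _ h1 h2.
  apply: le_trans (hM _ _ h3) _; apply: ler_wpM2l; first exact: normr_ge0.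
  by apply: lerXn2r => //; rewrite nnegrE ?mulr_ge0 ?(ltW p0) // le_max cabs_ge0.
(* One eighth for [g] and one eighth for [F(z, g)] make up the quarter allowed for [G]. *)
have [d d0 hd] := C1_conj_approx g hgC1 hg0 hgz hgzbar (1 / 8) ltac:(lra).
(* With [|z| <= p/10], the bound [5/4 |z|] for [g] and [G] is at most [p/8]. *)
pose r0 := Num.min d (Num.min (p / 10) (1 / 2)).
exists r0; first by rewrite !lt_min d0 !divr_gt0.
move=> r r_gt0; rewrite !lt_min => /and3P[rd rp r2].
have r12 : r <= 1 / 2 by exact: ltW.
pose G z := g z + F z (g z).
have gc z : cdisk r z -> cabs (g z - conjc z) <= 1 / 8 * cabs z.
  by move=> Dz; apply: hd; apply: le_lt_trans Dz rd.
have gc4 z : cdisk r z -> cabs (g z - conjc z) <= cabs z / 4.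
  by move=> /gc; have := cabs_ge0 z; lra.
have g2 z : cdisk r z -> cabs (g z) <= 5 / 4 * cabs z.
  exact: (close_le r g gc4).
have cD z : cdisk r z -> cabs z <= p / 10 by move=> h; apply: le_trans h (ltW rp).
have Fsmall z : cdisk r z -> cabs (F z (g z)) <= 1 / 8 * cabs z.
  move=> Dz; have z1 := cD z Dz; have z2 := g2 z Dz; have z0 : 0 <= cabs z := cabs_ge0 z.
  have [_ _ h3 _] := cs2 z (g z) ltac:(lra) ltac:(lra).
  apply: le_trans (hM _ _ h3) _.
  apply: le_trans (_ : M * (2 * cabs z) ^+ 3 <= _).
    apply: ler_wpM2l; first exact: normr_ge0.
    apply: lerXn2r; rewrite ?nnegrE ?mulr_ge0 // ?le_max ?z0 //.
    by rewrite ge_max; apply/andP; split; lra.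
  rewrite (_ : M * _ = (8 * (M * cabs z ^+ 2)) * cabs z); last by ring.
  apply: ler_wpM2r => //.
  have : M * cabs z ^+ 2 <= M * p ^+ 2.
    apply: ler_wpM2l; first exact: normr_ge0.
    by apply: lerXn2r; rewrite ?nnegrE ?(ltW p0) //; lra.
  lra.
have Gc4 z : cdisk r z -> cabs (G z - conjc z) <= cabs z / 4.
  move=> Dz; rewrite /G addrAC; apply: le_trans (cabsD _ _) _.
  by have := gc z Dz; have := Fsmall z Dz; lra.
pose D := dbl (cdisk r).
have Zp t : D t -> cabs (dblZ t) <= p / 4.
  by move=> /cD; rewrite cabs_sign; lra.
have Wgp t : D t -> cabs (dblW g t) <= p / 8.
  by move=> Dt; have := cD _ Dt; have := g2 _ Dt; rewrite cabs_sign; lra.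
have WGp t : D t -> cabs (dblW G t) <= p / 8.
  move=> Dt; have := cD _ Dt; have := close_le r G Gc4 _ Dt.
  by rewrite cabs_sign; lra.
have algebra f : (forall t, D t -> cabs (dblW f t) <= p / 8) ->
    closed_algebra D (poly_closure D dblZ (dblW f)).
  by move=> h; apply: (poly_closure_algebra _ _ _ (p / 4)) => t Dt; [exact: Zp|have := h t Dt; lra].
(* Oddness of [F] enters here: it gives the same formula on the negative sheet. *)
have WG_E t : D t -> dblW G t = dblW g t + F (dblZ t) (dblW g t).
  case: t => z s Dz; rewrite /dblW /dblZ /G /= mulrDr; congr (_ + _).
  case: s Dz => Dz; rewrite ?expr0 ?expr1 ?mul1r // !mulN1r hO //.
  have z1 := cD z Dz; have z2 := g2 z Dz; have z0 : 0 <= cabs z := cabs_ge0 z.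
  by have [] := cs2 z (g z) ltac:(lra) ltac:(lra).
have G_in_g : poly_closure D dblZ (dblW g) (dblW G).
  have hA := algebra g Wgp.
  apply: (ca_ext _ _ hA _ _ _ WG_E); apply: (ca_add _ _ hA); first exact: poly_closure2.
  apply: (hol2_in_algebra p p0 D _ hA F (M * (2 * p) ^+ 3)) => //.
  - exact: poly_closure1.
  - exact: poly_closure2.
  - by move=> t /Wgp; lra.
have g_in_G : poly_closure D dblZ (dblW G) (dblW g).
  have hA := algebra G WGp.
  (* [dblW g] is the fixed point of the contraction [w |-> dblW G - F(dblZ, w)]. *)
  pose w := fix w n (t : R[i] * bool) : R[i] :=
    if n is n'.+1 then dblW G t - F (dblZ t) (w n' t) else 0.
  have c4 (z : R[i]) : cabs z <= p / 4 -> csquare (p / 2) z.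
    by move=> h; apply: csquare_cabs; lra.
  have c1 (z : R[i]) : cabs z <= p / 4 -> csquare p z.
    by move=> /c4; apply: csquare_half.
  have z0 : csquare p (0 : R[i]) by apply: c1; rewrite cabs0; lra.
  (* The bound is [p/8] from [dblW G] plus [p/8] from [F]; [p/4] is what [hol2_in_algebra]
     admits. *)
  have wb n t : D t -> cabs (w n t) <= p / 4.
    move=> Dt; elim: n => [|n IH]; first by rewrite -[w 0%N t]/(0 : R[i]) cabs0; lra.
    rewrite -[w n.+1 t]/(dblW G t - F (dblZ t) (w n t)).
    apply: le_trans (cabsB _ _) _.
    have := Fb _ _ (c1 _ (Zp t Dt)) (c1 _ IH); have := WGp t Dt; lra.
  have wA n : poly_closure D dblZ (dblW G) (w n).
    elim: n => [|n IH]; first exact: (ca_const _ _ hA).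
    apply: (ca_sub _ _ hA); first exact: poly_closure2.
    apply: (hol2_in_algebra p p0 D _ hA F (M * (2 * p) ^+ 3)) => //.
      exact: poly_closure1.
    by move=> t; exact: wb.
  have wc n t : D t -> cabs (dblW g t - w n t) <= (1 / 2) ^+ n * (p / 4).
    move=> Dt; have hg : cabs (dblW g t) <= p / 4 by have := Wgp t Dt; lra.
    elim: n => [|n IH]; first by rewrite /= subr0 expr0 mul1r.
    have -> : dblW g t - w n.+1 t = F (dblZ t) (w n t) - F (dblZ t) (dblW g t).
      by rewrite /= WG_E //; ring.
    (* By the choice of [p], this Lipschitz constant in the second variable is at most 1/2. *)
    have hl := cauchy_lipschitz p p0 (F (dblZ t)) (M * (2 * p) ^+ 3) _ _ (w n t) (dblW g t)
      (c4 _ (wb n t Dt)) (c4 _ hg).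
    apply: le_trans (hl _ _) _.
    - move=> x hx; apply: (hol2_cdiff1 _ _ _ (hol2_swap _ _ _ (Fhol _ _ _ hx))).
      exact: c1 (Zp t Dt).
    - by move=> x hx; apply: Fb => //; exact: c1 (Zp t Dt).
    rewrite [(1 / 2) ^+ _]exprS -(mulrA (1 / 2)); apply: ler_pM; rewrite ?cabs_ge0 //.
      have F0 : 0 <= M * (2 * p) ^+ 3 by apply: le_trans (cabs_ge0 _) (Fb _ _ z0 z0).
      by apply: divr_ge0 (ltW p0); apply: mulr_ge0.
    by rewrite cabs_sub.
  apply: (ca_lim _ _ hA) => e e0.
  have [n hn] := @expr_small R (1 / 2) (e / p) ltac:(lra) ltac:(lra) ltac:(by rewrite divr_gt0).
  exists (w n) => // t Dt; apply: le_trans (wc n t Dt) _.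
  rewrite ler_pdivlMr // in hn.
  have h0 : 0 <= (1 / 2 : R) ^+ n by apply: exprn_ge0; lra.
  by have := mulr_ge0 h0 (ltW p0); lra.
(* Each direction is an inclusion between the closures themselves, applied to one [h]. *)
split=> H h /H.
- exact: (sqr_closure_transfer r G g h r12 Gc4 g_in_G).
- exact: (sqr_closure_transfer r g G h r12 gc4 G_in_g).
Qed.
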